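(* Fix positive integers $p\ge2$, $q$, a vector $\boldsymbol{\alpha}\in\mathbb{R}^q$, and a constant $w\in[0,1]$. Consider a sequence, indexed by $n\to\infty$, of multivariate allometric regression models as described in the context, with $\boldsymbol{X}=\boldsymbol{X}_n$ and $\boldsymbol{\Sigma}=\boldsymbol{\Sigma}_n$ depending on $n$, such that (i) $n^{-1}\boldsymbol{X}'\boldsymbol{X}$ converges to a finite positive-definite matrix; (ii) $\mathrm{tr}(\boldsymbol{\Sigma})=\Theta(1)$, $\mathrm{tr}(\boldsymbol{\Sigma}^2)=\Theta(1)$, and $\lambda_1-\lambda_2=\Theta(n^{-\eta})$ for some $\eta>0$. Then, as $n\to\infty$, \[ \min_{\theta\in\{-1,1\}} \| \theta\hat{\boldsymbol{\gamma}}_1(w)-\boldsymbol{\gamma}_1\| \to 0 \quad\text{in probability} \] holds under the following sufficient conditions: - for $w=0$: $\boldsymbol{\alpha}\neq\boldsymbol{0}_q$; - for $0<w<1$: $\boldsymbol{\alpha}\neq\boldsymbol{0}_q$ or $\eta<1/2$; - for $w=1$: $\eta<1/2$.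
   Context: Model (for each $n$). Let $n,p,q$ be positive integers with $p\ge 2$ and $n>1+q$. Let $\boldsymbol{X}$ be a deterministic real $n\times q$ matrix with $\mathrm{rank}(\boldsymbol{X})=q$ and $\boldsymbol{X}'\boldsymbol{1}_n=\boldsymbol{0}_q$ (here $'$ is transpose and $\boldsymbol{1}_n$ is the all-ones vector), $\boldsymbol{\mu}\in\mathbb{R}^p$, $\boldsymbol{\alpha}\in\mathbb{R}^q$. Let $\boldsymbol{\Sigma}$ be a $p\times p$ positive-definite matrix with eigenvalues $\lambda_1>\lambda_2\ge\cdots\ge\lambda_p>0$, and let $\boldsymbol{\gamma}_1$ be a unit eigenvector of $\boldsymbol{\Sigma}$ for $\lambda_1$ (all of these may depend on $n$ unless said to be fixed). The observed $n\times p$ matrix is \[ \boldsymbol{Y} = \boldsymbol{1}_n\boldsymbol{\mu}' + \boldsymbol{X}\boldsymbol{\alpha}\boldsymbol{\gamma}_1' + \boldsymbol{E},\qquad \mathrm{vec}(\boldsymbol{E})\sim \mathcal{N}_{np}(\boldsymbol{0}_{np},\boldsymbol{\Sigma}\otimes \boldsymbol{I}_n), \] i.e. the rows of $\boldsymbol{E}$ are i.i.d. $\mathcal{N}_p(\boldsymbol{0}_p,\boldsymbol{\Sigma})$. Estimators. Let \[ \boldsymbol{S}_R = \boldsymbol{Y}'\boldsymbol{X}(\boldsymbol{X}'\boldsymbol{X})^{-1}\boldsymbol{X}'\boldsymbol{Y},\qquad \boldsymbol{S}_E = \boldsymbol{Y}'\Bigl\{ \boldsymbol{I}_n - \tfrac1n\boldsymbol{1}_n\boldsymbol{1}_n'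 - \boldsymbol{X}(\boldsymbol{X}'\boldsymbol{X})^{-1}\boldsymbol{X}' \Bigr\}\boldsymbol{Y}, \] and $\boldsymbol{S}(w) = (1-w)\boldsymbol{S}_R + w\boldsymbol{S}_E$ for $0\le w\le 1$. The estimator $\hat{\boldsymbol{\gamma}}_1(w)$ is the first principal eigenvector of $\boldsymbol{S}(w)$, i.e. a unit eigenvector of $\boldsymbol{S}(w)$ corresponding to its largest eigenvalue. $\|\cdot\|$ is the Euclidean norm. Notation. For a sequence $(a_n)$, $a_n=\Theta(n^u)$ means $\liminf_{n\to\infty}(a_n/n^u)>0$ and $\limsup_{n\to\infty}(a_n/n^u)<\infty$. *)

(* Defs.v *)
From HB Require Import structures.
From mathcomp Require Import all_boot all_order all_algebra.
From mathcomp Require Import mxtens.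
From mathcomp Require Import all_classical all_reals all_analysis.
Set Implicit Arguments.
Unset Strict Implicit.
Unset Printing Implicit Defensive.
Import Order.TTheory GRing.Theory Num.Theory.
Import numFieldNormedType.Exports.
Local Open Scope classical_set_scope.
Local Open Scope ring_scope.

Section LinearAlgebra.
Variable R : realType.

Definition ones n : 'cV[R]_n := const_mx 1.

Definition enorm k (v : 'cV[R]_k) : R := Num.sqrt (\sum_i v i 0 ^+ 2).

Definition posdef k (A : 'M[R]_k) : Prop :=
  A^T = A /\ forall v : 'cV[R]_k, v != 0 -> 0 < (v^T *m A *m v) 0 0.

(* Eigenvalues are listed with multiplicity, in nonincreasing order. *)
Definition ordered_eigenvalues k (A : 'M[R]_k) (lam : k.-tuple R) : Prop :=
  char_poly A = \prod_(l <- lam) ('X - l%:P) /\ sorted >=%R lam.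

(* [eigenvalue] is about row vectors; a matrix and its transpose have the same
   eigenvalues, and the predicate is only used for symmetric [A]. *)
Definition first_eigenvector k (A : 'M[R]_k) (v : 'cV[R]_k) : Prop :=
  enorm v = 1 /\
  exists2 l : R, A *m v = l *: v & forall m : R, eigenvalue A m -> m <= l.

(* Columns are stacked, in the indexing of the Kronecker product [*t]: entry
   [j * n + i] of [vec A] is [A i j]. *)
Definition vec n p (A : 'M[R]_(n, p)) : 'cV[R]_(p * n) :=
  \col_k A (mxtens_unindex k).2 (mxtens_unindex k).1.

End LinearAlgebra.
Arguments ones {R} n.

Section Probability.
Variable R : realType.

(* The library's [normal_prob m 0] is not the point mass at [m] (it is the
   uniform distribution on [0, 1]), so the degenerate case is separate. *)
Definition normal_law (m v : R) (A : set R) : \bar R :=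
  if v == 0 then \d_m A else normal_prob m (Num.sqrt v) A.

Definition random_matrix d (T : measurableType d) m n
    (Z : T -> 'M[R]_(m, n)) : Prop :=
  forall i j, measurable_fun [set: T] (fun x => Z x i j).

(* Z ~ N_k(m, V): every linear form t'Z has the law N(t'm, t'Vt). *)
Definition multivariate_normal d (T : measurableType d) (P : probability T R)
    k (Z : T -> 'cV[R]_k) (m : 'cV[R]_k) (V : 'M[R]_k) : Prop :=
  random_matrix Z /\
  forall (t : 'cV[R]_k) (A : set R), measurable A ->
    pushforward P (fun x => (t^T *m Z x) 0 0) A =
    normal_law ((t^T *m m) 0 0) ((t^T *m V *m t) 0 0) A.

(* The probability space may change along the sequence. *)
Definition cvg_to0_in_probability (d : nat -> measure_display)
    (T : forall n, measurableType (d n)) (P : forall n, probability (T n) R)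
    (D : forall n, T n -> R) : Prop :=
  forall eps : R, 0 < eps ->
    P n [set x | eps < `|D n x|] @[n --> \oo] --> 0%E.

(* a_n = Theta(n^u) *)
Definition theta_pow (a : nat -> R) (u : R) : Prop :=
  (0 < limn_einf (fun n => (a n / n%:R `^ u)%:E))%E /\
  (limn_esup (fun n => (a n / n%:R `^ u)%:E) < +oo)%E.

End Probability.

Section Model.
Variable R : realType.

Record allometric_regression d (T : measurableType d) (P : probability T R)
    n p q (X : 'M[R]_(n, q)) (mu : 'cV[R]_p) (alpha : 'cV[R]_q)
    (Sigma : 'M[R]_p) (lam : p.-tuple R) (gamma1 : 'cV[R]_p)
    (E Y : T -> 'M[R]_(n, p)) : Prop := {
  design_rank : \rank X = q;
  design_centered : X^T *m ones n = 0;
  Sigma_posdef : posdef Sigma;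
  Sigma_eigenvalues : ordered_eigenvalues Sigma lam;
  eigenvalues_gt0 : forall l, l \in lam -> 0 < l;
  first_eigenvalue_simple : lam`_1 < lam`_0;
  gamma1_unit : enorm gamma1 = 1;
  gamma1_eigen : Sigma *m gamma1 = lam`_0 *: gamma1;
  error_normal : multivariate_normal P (fun x => vec (E x)) 0 (Sigma *t 1%:M);
  responseE : forall x : T,
    Y x = ones n *m mu^T + X *m alpha *m gamma1^T + E x
}.

Definition hat_mx n q (X : 'M[R]_(n, q)) : 'M[R]_n :=
  X *m invmx (X^T *m X) *m X^T.

Definition S_R n p q (X : 'M[R]_(n, q)) (Y : 'M[R]_(n, p)) : 'M[R]_p :=
  Y^T *m hat_mx X *m Y.

Definition S_E n p q (X : 'M[R]_(n, q)) (Y : 'M[R]_(n, p)) : 'M[R]_p :=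
  Y^T *m (1%:M - n%:R^-1 *: (ones n *m (ones n)^T) - hat_mx X) *m Y.

Definition S_w n p q (w : R) (X : 'M[R]_(n, q)) (Y : 'M[R]_(n, p)) : 'M[R]_p :=
  (1 - w) *: S_R X Y + w *: S_E X Y.

(* min over theta in {-1, 1} of || theta g - gamma || *)
Definition sign_dist p (g gamma : 'cV[R]_p) : R :=
  Num.min (enorm (-1 *: g - gamma)) (enorm (1 *: g - gamma)).

End Model.

(* Main.v *)
(** Up to noise, [n^-1 S(w)] is
    [(1 - w) c gamma1 gamma1' + w Sigma], where [c = n^-1 |X alpha|^2]; its top
    eigenvector is [gamma1], with gap [(1 - w) c + w (lambda_1 - lambda_2)].
    Comparing Rayleigh quotients, the squared distance from the estimator to
    [+-gamma1] is at most four times the size of the noise divided by the gap.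
    The noise is a combination of squared linear forms in [E] and of
    [n^-1 E'E - Sigma]. Its mean is O(n^(-1/2)): second and fourth moments of
    linear forms suffice, since mixed fourth moments follow by polarization.
    Markov's inequality then gives consistency as soon as the gap dominates
    [n^(-theta)] for some [theta < 1/2]: [theta = 0] when the signal
    [(1 - w) c] is bounded below, and [theta = eta] when [w > 0]. *)
Require Import Defs.
From HB Require Import structures.
From mathcomp Require Import all_boot all_order all_algebra.
From mathcomp Require Import mxtens.
From mathcomp Require Import all_classical all_reals all_analysis.
From mathcomp Require Import measurable_realfun.
From mathcomp Require Import ring lra.
Set Implicit Arguments.
Unset Strict Implicit.
Unset Printing Implicit Defensive.
Import Order.TTheory GRing.Theory Num.Theory.
Import numFieldNormedType.Exports.
Local Open Scope classical_set_scope.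
Local Open Scope ring_scope.

(** The estimator depends on the noise, so the noise form is bounded uniformly over unit vectors
    before any expectation is taken. Frobenius norms do this: they dominate every [v'Av], and their
    squares are sums of squared entries, whose moments reduce to those of linear forms. Absolute
    values are traded for second moments through [2|y| <= y^2/r + r] with [r = sqrt n]; hence noise
    of size [sqrt n] in the unnormalized [S(w)], against [n] times the gap. Expectations are taken
    of nonnegative functions only, with values in [[0, +oo]], and identities between them are
    rearranged so that nothing is subtracted; integrability is then never a side condition. The
    factor four is two times two: the noise enters once at the estimator and once at [gamma1], and
    [2 - 2|s| <= 2(1 - s^2)] for the cosine [s] between them. *)

(** * Quadratic forms, Rayleigh quotients and the spectral gap *)

Section SymmetricMatrices.
Variable R : realType.

Lemma cvg_sumr (I : Type) (r : seq I) (U : Type) (F : set_system U)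
    (f : I -> U -> R) (l : I -> R) : Filter F ->
  (forall i, f i x @[x --> F] --> l i) ->
  \sum_(i <- r) f i x @[x --> F] --> \sum_(i <- r) l i.
Proof.
move=> FF fl; elim: r => [|i r IH].
  by under eq_fun do rewrite big_nil; rewrite big_nil; exact: cvg_cst.
under eq_fun do rewrite big_cons.
by rewrite big_cons; apply: cvgD.
Qed.

Definition mform k (A : 'M[R]_k) (u v : 'cV[R]_k) : R := (u^T *m A *m v) 0 0.

Lemma mformE k (A : 'M[R]_k) u v :
  mform A u v = \sum_i \sum_j u i 0 * A i j * v j 0.
Proof.
rewrite /mform mxE exchange_big /=; apply: eq_bigr => j _.
rewrite mxE mulr_suml; apply: eq_bigr => i _.
by rewrite mxE.
Qed.

Lemma mformDl k (A : 'M[R]_k) u u' v : mform A (u + u') v = mform A u v + mform A u' v.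
Proof. by rewrite /mform linearD /= !mulmxDl mxE. Qed.

Lemma mformDr k (A : 'M[R]_k) u v v' : mform A u (v + v') = mform A u v + mform A u v'.
Proof. by rewrite /mform mulmxDr mxE. Qed.

Lemma mformZl k (A : 'M[R]_k) a u v : mform A (a *: u) v = a * mform A u v.
Proof. by rewrite /mform linearZ /= -!scalemxAl mxE. Qed.

Lemma mformZr k (A : 'M[R]_k) a u v : mform A u (a *: v) = a * mform A u v.
Proof. by rewrite /mform -scalemxAr mxE. Qed.

Lemma mformDm k (A B : 'M[R]_k) u v : mform (A + B) u v = mform A u v + mform B u v.
Proof. by rewrite /mform mulmxDr mulmxDl mxE. Qed.

Lemma mformZm k a (A : 'M[R]_k) u v : mform (a *: A) u v = a * mform A u v.
Proof. by rewrite /mform -scalemxAr -scalemxAl mxE. Qed.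

Lemma mformBm k (A B : 'M[R]_k) u v : mform (A - B) u v = mform A u v - mform B u v.
Proof. by rewrite mformDm -scaleN1r mformZm mulN1r. Qed.

Lemma mform_sym k (A : 'M[R]_k) u v : A^T = A -> mform A u v = mform A v u.
Proof.
move=> sA; rewrite /mform -[in LHS]sA.
have -> : u^T *m A^T *m v = (v^T *m A *m u)^T.
  by rewrite !trmx_mul trmxK mulmxA.
by rewrite mxE.
Qed.

Lemma mform_eigen k (A : 'M[R]_k) u v l :
  A *m v = l *: v -> mform A u v = l * mform 1%:M u v.
Proof. by move=> Av; rewrite /mform -mulmxA Av mulmx1 -scalemxAr mxE. Qed.

Lemma mform1E k (u v : 'cV[R]_k) : mform 1%:M u v = \sum_i u i 0 * v i 0.
Proof. by rewrite /mform mulmx1 mxE; apply: eq_bigr => i _; rewrite mxE. Qed.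

Lemma mform1_ge0 k (v : 'cV[R]_k) : 0 <= mform 1%:M v v.
Proof. by rewrite mform1E sumr_ge0// => i _; rewrite -expr2 sqr_ge0. Qed.

Lemma mform1_eq0 k (v : 'cV[R]_k) : mform 1%:M v v = 0 -> v = 0.
Proof.
rewrite mform1E => /eqP; rewrite psumr_eq0 => [/allP h|i _]; last first.
  by rewrite -expr2 sqr_ge0.
apply/colP => i; rewrite mxE; apply/eqP.
by have := h i (mem_index_enum _); rewrite /= -expr2 sqrf_eq0.
Qed.

Lemma mform_rank1 k (u v : 'cV[R]_k) : mform (u *m u^T) v v = mform 1%:M u v ^+ 2.
Proof.
rewrite {1}/mform !mulmxA -mulmxA mxE big_ord1 expr2; congr (_ * _).
  by rewrite mform_sym ?trmx1// /mform mulmx1.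
by rewrite /mform mulmx1.
Qed.

Lemma mform_delta k (A : 'M[R]_k) i j : mform A (delta_mx i 0) (delta_mx j 0) = A i j.
Proof. by rewrite /mform trmx_delta -rowE -colE !mxE. Qed.

Lemma posdef_mform_ge0 k (A : 'M[R]_k) v : posdef A -> 0 <= mform A v v.
Proof.
move=> [_ A0]; have [->|v0] := eqVneq v 0; first by rewrite /mform mulmx0 mxE.
exact/ltW/A0.
Qed.

Lemma posdef_trace_ge0 k (A : 'M[R]_k) : posdef A -> 0 <= \tr A.
Proof.
by move=> A0; apply: sumr_ge0 => i _; rewrite -mform_delta posdef_mform_ge0.
Qed.

Lemma enorm_sqr k (v : 'cV[R]_k) : enorm v ^+ 2 = mform 1%:M v v.
Proof.
rewrite /enorm sqr_sqrtr; last by rewrite sumr_ge0// => i _; rewrite sqr_ge0.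
by rewrite mform1E; apply: eq_bigr => i _; rewrite expr2.
Qed.

Lemma enorm1 k (v : 'cV[R]_k) : enorm v = 1 -> mform 1%:M v v = 1.
Proof. by move=> v1; rewrite -enorm_sqr v1 expr1n. Qed.

(* A maximizer of the form on the unit sphere is an eigenvector, so no spectral
   theorem is needed. *)
Lemma rayleigh_max k (A : 'M[R]_k) (l : R) (v : 'cV[R]_k) : A^T = A ->
  (forall m, eigenvalue A m -> m <= l) -> mform A v v <= l * mform 1%:M v v.
Proof.
move=> sA lmax.
have [->|v0] := eqVneq v 0; first by rewrite /mform !mulmx0 !mxE mulr0.
(* Row vectors, because the compactness and extreme value results used below are stated for them. *)
pose f (x : 'rV[R]_k) := mform A x^T x^T.
pose K := [set x : 'rV[R]_k | mform 1%:M x^T x^T = 1].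
have contf B : continuous (fun x : 'rV[R]_k => mform B x^T x^T).
  move=> x.
  have -> : (fun x : 'rV[R]_k => mform B x^T x^T) =
      fun x : 'rV[R]_k => \sum_i \sum_j x 0 i * B i j * x 0 j.
    apply/funext => y; rewrite mformE; apply: eq_bigr => i _.
    by apply: eq_bigr => j _; rewrite !mxE.
  apply: (@cvg_sumr _ _ _ (nbhs x) _ _ (nbhs_filter x)) => i.
  apply: (@cvg_sumr _ _ _ (nbhs x) _ _ (nbhs_filter x)) => j.
  apply: cvgM; last exact: coord_continuous.
  by apply: cvgM; [exact: coord_continuous|exact: cvg_cst].
have K0 (u : 'cV[R]_k) : u != 0 -> exists2 c : R, 0 < c & K ((c *: u)^T).
  move=> u0; pose s := mform 1%:M u u.
  have s0 : 0 < s.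
    rewrite lt_def mform1_ge0 andbT; apply: contra u0 => /eqP s0.
    exact/eqP/mform1_eq0.
  exists (Num.sqrt s)^-1; first by rewrite invr_gt0 sqrtr_gt0.
  rewrite /K /= trmxK mformZl mformZr mulrA -invfM -expr2 sqr_sqrtr ?ltW//.
  by rewrite mulVf// gt_eqF.
have Kc : compact K.
  apply: bounded_closed_compact.
    exists 1; split=> // r r1 x Kx /=; apply: le_trans (ltW r1).
    rewrite {1}/Num.norm /= mx_normrE; apply: bigmax_le => //= -[i j] _ /=.
    rewrite ord1 -(@ler_pXn2r _ 2%N) ?nnegrE// expr1n real_normK ?num_real//.
    rewrite -Kx mform1E (bigD1 j)//= !mxE -expr2 lerDl sumr_ge0// => m _.
    by rewrite -expr2 sqr_ge0.
  apply: (@closed_comp _ _ (fun x : 'rV[R]_k => mform 1%:M x^T x^T) [set 1]).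
    by move=> x _; exact: contf.
  exact: closed_eq.
have [c0 _ Kv] := K0 _ v0.
have Kne : K !=set0 by eexists; exact: Kv.
have [c cK cmax] := EVT_max_rV Kne Kc (continuous_subspaceT (contf A)).
set u := c^T; set m := mform A u u.
have u1 : mform 1%:M u u = 1 by move: cK; rewrite inE.
have mle x : mform A x x <= m * mform 1%:M x x.
  have [->|x0] := eqVneq x 0; first by rewrite /mform !mulmx0 !mxE mulr0.
  have [e e0 Kx] := K0 _ x0.
  have := cmax (e *: x)^T; rewrite inE => /(_ Kx).
  rewrite /f trmxK mformZl mformZr -/u -/m => h.
  move: Kx; rewrite /K /= trmxK mformZl mformZr => h1.
  have e20 : 0 < e * e by rewrite mulr_gt0.
  by rewrite -(ler_pM2l e20) (mulrCA _ m) -!(mulrA e e) h1 mulr1.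
(* [N = m - A] is positive semidefinite and its form vanishes at [u], which forces [N u = 0]:
   otherwise moving from [u] along [- N u] would make the form negative. *)
have Au : A *m u = m *: u.
  pose N := m *: 1%:M - A; pose h := N *m u.
  have sN : N^T = N by rewrite /N linearB /= linearZ /= trmx1 sA.
  have N0 x : 0 <= mform N x x by rewrite mformBm mformZm subr_ge0.
  have Nuu : mform N u u = 0 by rewrite mformBm mformZm u1 mulr1 subrr.
  have Nhu : mform N h u = mform 1%:M h h.
    by rewrite /mform mulmx1 /h !mulmxA.
  suff : h = 0.
    by move=> /eqP; rewrite /h /N mulmxBl subr_eq0 -scalemxAl mul1mx => /eqP ->.
  apply: mform1_eq0; rewrite -Nhu; apply/eqP; rewrite eq_le Nhu mform1_ge0 andbT.
  set D : R := mform 1%:M h h; rewrite leNgt; apply/negP => D0.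
  set C : R := mform N h h.
  have C0 : 0 <= C := N0 h.
  have q (t : R) : 0 <= - 2 * t * D + t ^+ 2 * C.
    have := N0 (u + (- t) *: h).
    rewrite mformDl !mformDr !mformZl !mformZr Nuu (mform_sym _ _ sN) Nhu.
    rewrite -/D -/C; lra.
  (* The quadratic in [t] is least at [D / C]; the added 1 covers [C = 0] and still gives a negative
     value. *)
  have := q (D / (C + 1)).
  have C1 : 0 < C + 1 by lra.
  have -> : - 2 * (D / (C + 1)) * D + (D / (C + 1)) ^+ 2 * C =
    - (D ^+ 2 * (C + 2) / (C + 1) ^+ 2) by field; rewrite gt_eqF.
  rewrite oppr_ge0 leNgt => /negP; apply.
  by rewrite divr_gt0// ?mulr_gt0 ?exprn_gt0//; lra.
have mev : eigenvalue A m.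
  apply/eigenvalueP; exists u^T.
    by rewrite -[in LHS]sA -trmx_mul Au linearZ.
  apply/negP => /eqP u0.
  have /eqP := u1; rewrite /mform u0 !mul0mx mxE eq_sym oner_eq0.
  by [].
apply: le_trans (mle v) _.
by rewrite ler_wpM2r ?mform1_ge0// lmax.
Qed.


(* Multiplied by [y] so that it holds over any commutative ring: it is used over
   polynomials, where [y] is not a unit. *)
Lemma det_scalar_rank1 (D : comNzRingType) k (y t : D) (u : 'cV[D]_k) (v : 'rV[D]_k) :
  y * \det (y%:M + t *: (u *m v)) = y ^+ k * (y + t * (v *m u) 0 0).
Proof.
(* Sylvester's determinant identity: eliminating either diagonal block of this bordered matrix
   leaves one of the two Schur complements. *)
pose M : 'M[D]_(1 + k) := block_mx 1%:M (- v) (t *: u) y%:M.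
have M1 : M = block_mx 1%:M 0 (t *: u) 1%:M *m
              block_mx 1%:M (- v) 0 (y%:M + t *: (u *m v)).
  rewrite mulmx_block !mul1mx !mulmx1 !mul0mx !addr0.
  by congr block_mx; rewrite ?addr0// mulmxN -scalemxAl addrCA addNr addr0.
have M2 : M *m block_mx y%:M 0 (- t *: u) 1%:M =
          block_mx (y + t * (v *m u) 0 0)%:M (- v) 0 y%:M.
  rewrite mulmx_block !mul1mx !mulmx0 !mulmx1 !add0r; congr block_mx.
    rewrite mulNmx -scalemxAr scaleNr opprK raddfD /=; congr (_ + _).
    by rewrite [X in t *: X]mx11_scalar scale_scalar_mx.
  by rewrite mul_mx_scalar mul_scalar_mx !scalerA mulrN scaleNr subrr.
have := congr1 determinant M2; rewrite det_mulmx M1 det_mulmx.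
rewrite !(det_lblock, det_ublock) !det1 !mul1r !det_scalar !expr1 mulr1.
by rewrite mulrC => ->; rewrite mulrC.
Qed.

(** Since [('X - A) g = ('X - l) g], the deflated characteristic matrix times ['X - l] factors as
    [('X - A) ('X - l + t g g')]. The determinant of the second factor comes from the rank-one
    formula, and the root [l] moves to [l - t]. *)
Lemma char_poly_deflation k (A : 'M[R]_k) (g : 'cV[R]_k) (l t : R) :
  A *m g = l *: g -> mform 1%:M g g = 1 ->
  ('X - l%:P) * char_poly (A - t *: (g *m g^T)) = char_poly A * ('X - (l - t)%:P).
Proof.
move=> Ag g1; pose G := map_mx polyC g; set y := 'X - l%:P.
have GG : (G^T *m G) 0 0 = 1.
  by rewrite map_trmx -map_mxM mxE; move: g1; rewrite /mform mulmx1 => ->.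
have BG : char_poly_mx A *m G = y *: G.
  rewrite /char_poly_mx mulmxBl -map_mxM Ag mul_scalar_mx map_mxZ scalerBl.
  by [].
have E : y *: char_poly_mx (A - t *: (g *m g^T)) =
    char_poly_mx A *m (y%:M + t%:P *: (G *m G^T)).
  rewrite mulmxDr mul_mx_scalar -scalemxAr mulmxA BG -scalemxAl.
  rewrite [t%:P *: _]scalerA mulrC -scalerA -scalerDr; congr (_ *: _).
  by rewrite /char_poly_mx map_mxB map_mxZ map_mxM -map_trmx opprB addrA addrAC.
have y0 : y ^+ k != 0 by rewrite expf_neq0// polyXsubC_eq0.
apply: (mulfI y0); rewrite mulrCA /char_poly -detZ E det_mulmx mulrCA.
rewrite det_scalar_rank1 GG mulr1 mulrCA; congr (_ * (_ * _)).
by rewrite /y polyCB opprB addrA addrAC.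
Qed.

(* The deflated matrix [A - (lam_0 - lam_1) g g'] has no eigenvalue above [lam_1]:
   its characteristic polynomial is that of [A] with one root moved. *)
Lemma mform_spectral_gap k (A : 'M[R]_k) (lam : k.-tuple R) (g v : 'cV[R]_k) :
  (2 <= k)%N -> A^T = A -> ordered_eigenvalues A lam ->
  A *m g = lam`_0 *: g -> enorm g = 1 ->
  mform A v v <= lam`_1 * mform 1%:M v v + (lam`_0 - lam`_1) * mform 1%:M g v ^+ 2.
Proof.
move=> k2 sA [Alam slam] Ag /enorm1 g1.
move: (size_tuple lam) Alam slam Ag; case: (tval lam) => [|l1 [|l2 s]] /=; rewrite ?big_cons.
- by move=> k0; rewrite -k0 in k2.
- by move=> k1; rewrite -k1 in k2.
move=> _ Alam /andP[l12 l2s] Ag; set t := l1 - l2.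
pose B := A - t *: (g *m g^T).
have sB : B^T = B.
  by rewrite /B linearB /= linearZ /= trmx_mul trmxK sA.
have Beig m : eigenvalue B m -> m <= l2.
  rewrite eigenvalue_root_char.
  (* With [t = l1 - l2] the moved root lands on [l2], which bounds all the remaining roots because
     the list is nonincreasing. *)
  have := char_poly_deflation t Ag g1; rewrite Alam -mulrA => /mulfI -> ; last first.
    by rewrite polyXsubC_eq0.
  rewrite /t subKr !rootM root_XsubC root_prod_XsubC.
  move=> /orP[/orP[/eqP->//|ms]|/eqP->//].
  move: l2s; rewrite (path_sortedE ge_trans) => /andP[/allP/(_ _ ms)].
  by [].
have := rayleigh_max v sB Beig.
by rewrite /B mformBm mformZm mform_rank1 lerBlDr.
Qed.

(** [u] maximizes the form of [S], so [g] does not beat it there, while for [A] passing from [g] to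
    [u] loses at least [d (1 - s^2)]. The perturbation must pay for this loss, at most [W] at each
    of the two vectors. *)
Lemma sign_dist_perturbation k (S A : 'M[R]_k) (u g : 'cV[R]_k) (a d W : R) :
  S^T = S -> first_eigenvector S u -> enorm g = 1 -> 0 <= d ->
  (forall v, mform A v v <= a * mform 1%:M v v + d * mform 1%:M g v ^+ 2) ->
  mform A g g = a + d ->
  (forall v, mform 1%:M v v = 1 -> `|mform (S - A) v v| <= W) ->
  d * sign_dist u g ^+ 2 <= 4 * W.
Proof.
move=> sS [/enorm1 u1 [l Su lmax]] /enorm1 g1 d0 Ale Ag SA.
set s : R := mform 1%:M g u.
have su : mform S u u = l by rewrite (mform_eigen _ Su) u1 mulr1.
have sg := rayleigh_max g sS lmax; rewrite g1 mulr1 in sg.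
have := SA _ u1; have := SA _ g1; rewrite !mformBm su Ag !ler_norml.
have := Ale u; rewrite u1 mulr1 -/s => Au /andP[h1 h2] /andP[h3 h4].
have {}Au : d * (1 - s ^+ 2) <= 2 * W by lra.
have nrm (e : R) : e ^+ 2 = 1 -> enorm (e *: u - g) ^+ 2 = 2 - 2 * (e * s).
  move=> e1; rewrite enorm_sqr -scaleN1r mformDl !mformDr !mformZl !mformZr u1 g1.
  rewrite (mform_sym u g) ?trmx1// -/s mulr1 -expr2 e1; ring.
have e0 (w : 'cV[R]_k) : 0 <= enorm w by exact: sqrtr_ge0.
have n1 := nrm 1 (expr1n _ _); rewrite mul1r in n1.
have n2 : enorm (-1 *: u - g) ^+ 2 = 2 + 2 * s by rewrite nrm ?sqrrN ?expr1n//; ring.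
have s1 : s <= 1 by have := sqr_ge0 (enorm (1 *: u - g)); rewrite n1; lra.
have s2 : - 1 <= s by have := sqr_ge0 (enorm (-1 *: u - g)); rewrite n2; lra.
have m0 : 0 <= sign_dist u g by rewrite /sign_dist le_min !e0.
suff : sign_dist u g ^+ 2 <= 2 * (1 - s ^+ 2) by nra.
have [s0|s0] := leP 0 s.
- apply: (@le_trans _ _ (enorm (1 *: u - g) ^+ 2)); last by rewrite n1; nra.
  by rewrite ler_pXn2r ?nnegrE// /sign_dist ge_min lexx orbT.
- apply: (@le_trans _ _ (enorm (-1 *: u - g) ^+ 2)); last by rewrite n2; nra.
  by rewrite ler_pXn2r ?nnegrE// /sign_dist ge_min lexx.
Qed.

End SymmetricMatrices.

(** * Second and fourth moments of a centered normal law *)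

Section GaussianMoments.
Variable R : realType.
Variable s : R.
Hypothesis s0 : 0 < s.
Local Notation mu := (@lebesgue_measure R).
Local Notation g := (normal_fun 0 s).

Let a := s ^+ 2.
Let as_ : a = s ^+ 2. Proof. by []. Qed.
Let a0 : 0 < a. Proof. by rewrite exprn_gt0. Qed.

Let normal_funE : g = expR \o horner (- (2 * a)^-1 *: 'X^2).
Proof.
apply/funext => x; rewrite /normal_fun /= hornerZ hornerXn subr0; congr expR.
by rewrite -/a mulNr mulrC mulNr mulr_natl.
Qed.

(** The Stein operator of the normal law of variance [a]: the derivative of [p g] is [gauss_dual p]
    times [g]. *)
Definition gauss_dual (p : {poly R}) : {poly R} := p^`() - a^-1 *: ('X * p).

Lemma is_derive_poly_gauss (p : {poly R}) (x : R) :
  is_derive x (1 : R) (fun y => p.[y] * g y) ((gauss_dual p).[x] * g x).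
Proof.
have dg : is_derive x (1 : R) g (- (x / a) * g x).
  rewrite normal_funE.
  pose q := - (2 * a)^-1 *: 'X^2 : {poly R}.
  apply: (is_derive_eq (is_derive1_comp (is_derive_expR q.[x]) (is_derive_poly q x))).
  have -> : q^`().[x] = - (x / a).
    by rewrite /q derivZ derivXn !hornerE /= /a; field; rewrite gt_eqF.
  by rewrite mulrC.
have -> : (fun y => p.[y] * g y) = horner p * g by [].
apply: is_derive_eq => /=.
rewrite /gauss_dual !hornerE /= /GRing.scale /=; ring.
Qed.

Lemma continuous_poly_gauss (p : {poly R}) : continuous (fun y => p.[y] * g y).
Proof.
move=> x; apply: (@differentiable_continuous _ R^o R^o); apply/derivable1_diffP.
by have [] := is_derive_poly_gauss p x.
Qed.

(** It suffices to treat monomials. One term of the exponential series, [expR y >= y^(n+1) / (n+1)!]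
    at [y = x^2 / (2a)], gives [x^n g x <= C / x] for [x >= 1], which dictates [C]. *)
Lemma cvg_poly_gauss (p : {poly R}) : p.[x] * g x @[x --> +oo] --> (0 : R).
Proof.
have cvgX n : x ^+ n * g x @[x --> +oo] --> (0 : R).
  pose C := n.+1`!%:R * (2 * a) ^+ n.+1.
  have C0 : 0 < C by rewrite mulr_gt0 ?ltr0n ?fact_gt0// exprn_gt0// mulr_gt0.
  have invx : C * x^-1 @[x --> +oo] --> (0 : R).
    rewrite -(mulr0 C); apply: cvgM; first exact: cvg_cst.
    by apply/(@gtr0_cvgV0 _ _ _ _ id); [exact: nbhs_pinfty_gt|exact: cvg_id].
  apply: (squeeze_cvgr _ (cvg_cst 0) invx); near=> x.
  have x1 : 1 <= x by near: x; exact: nbhs_pinfty_ge.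
  have x0 : 0 < x by exact: lt_le_trans x1.
  apply/andP; split; first by rewrite mulr_ge0 ?expR_ge0// exprn_ge0// ltW.
  pose y := x ^+ 2 / (2 * a).
  have y0 : 0 <= y by rewrite divr_ge0 ?sqr_ge0// ltW// mulr_gt0.
  have -> : g x = (expR y)^-1.
    by rewrite normal_funE -expRN /= hornerZ hornerXn /y mulNr mulrC.
  rewrite ler_pdivrMr ?expR_gt0//.
  have h : y ^+ n.+1 / n.+1`!%:R <= expR y.
    by apply: le_trans (expR_ge1Dxn n y0); rewrite lerDr.
  apply: le_trans (ler_wpM2l _ h); last first.
    by rewrite mulr_ge0 ?ltW// invr_gt0.
  rewrite /C /y expr_div_n -exprM.
  rewrite [leRHS](_ : _ = x ^+ (2 * n.+1) / x); last first.
    field; rewrite !gt_eqF ?exprn_gt0 ?mulr_gt0 ?ltr0n ?fact_gt0//.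
  rewrite mul2n -addnn addnS exprS mulrC mulKf ?gt_eqF// addSnnS exprD ler_peMr//.
    by rewrite exprn_ge0// ltW.
  by rewrite exprn_ege1.
have -> : (fun x => p.[x] * g x) = (fun x => \sum_(i < size p) p`_i * (x ^+ i * g x)).
  apply/funext => x; rewrite horner_coef mulr_suml; apply: eq_bigr => i _.
  by rewrite mulrA.
have h (i : 'I_(size p)) : p`_i * (x ^+ i * g x) @[x --> +oo] --> p`_i * 0.
  by apply: cvgM; [exact: cvg_cst|exact: cvgX].
have := @cvg_sumr _ _ (index_enum _) _ _ _ _ _ h.
have E : \sum_(i < size p) p`_i * 0 = 0 :> R by rewrite big1// => i _; rewrite mulr0.
by rewrite E; apply.
Unshelve. all: by end_near. Qed.

(** The integrand is the derivative of [p g], which vanishes at [+oo] and equals [p.[0]] at 0. *)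
Lemma integral0y_gauss_dual (p : {poly R}) :
  (forall x, 0 <= x -> 0 <= (gauss_dual p).[x]) ->
  (\int[mu]_(x in `[0%R, +oo[) ((gauss_dual p).[x] * g x)%:E = (- p.[0])%:E)%E.
Proof.
move=> p0.
rewrite (@ge0_continuous_FTC2y _ _ (fun x => p.[x] * g x) 0 0).
- by rewrite /normal_fun subrr expr0n /= oppr0 mul0r expR0 mulr1 -EFinB sub0r.
- by move=> x x0; rewrite mulr_ge0 ?p0// expR_ge0.
- exact/continuous_subspaceT/continuous_poly_gauss.
- exact: cvg_poly_gauss.
- by move=> x _; have [] := is_derive_poly_gauss p x.
- exact/cvg_at_right_filter/continuous_poly_gauss.
- by move=> x _; rewrite derive1E; have [_ ->] := is_derive_poly_gauss p x.
Qed.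

(** Half-line integrals against the unnormalized weight; [integral_normalX] restores the
    normalization and the other half. *)
Let H (p : {poly R}) : \bar R :=
  (\int[mu]_(x in `[0%R, +oo[) ((p.[x] * g x)%R)%:E)%E.

Let mpg (p : {poly R}) (D : set R) : measurable D ->
  measurable_fun D (EFin \o (fun x => p.[x] * g x)).
Proof.
move=> mD; apply/measurable_EFinP; apply: measurable_funTS.
by apply: continuous_measurable_fun; exact: continuous_poly_gauss.
Qed.

Let posp (p : {poly R}) := forall x, 0 <= x -> 0 <= p.[x].

Let HD p q : posp p -> posp q -> H (p + q) = (H p + H q)%E.
Proof.
move=> p0 q0; rewrite /H -ge0_integralD//=; last 4 first.
- move=> x; rewrite in_itv /= andbT => x0.
  by rewrite lee_fin mulr_ge0 ?expR_ge0// p0.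
- exact: mpg.
- move=> x; rewrite in_itv /= andbT => x0.
  by rewrite lee_fin mulr_ge0 ?expR_ge0// q0.
- exact: mpg.
by apply: eq_integral => x _; rewrite hornerD mulrDl.
Qed.

Let HZ (c : R) p : 0 <= c -> posp p -> H (c *: p) = (c%:E * H p)%E.
Proof.
move=> c0 p0; rewrite /H -ge0_integralZl_EFin//=; last 2 first.
- move=> x; rewrite in_itv /= andbT => x0.
  by rewrite lee_fin mulr_ge0 ?expR_ge0// p0.
- exact: mpg.
by apply: eq_integral => x _; rewrite hornerZ -EFinM mulrA.
Qed.

(** Odd powers of [x] times [g] have an antiderivative of the form [p g], so their integrals are
    explicit; even powers only reduce to lower even ones. The odd ones serve as positive corrections
    below. *)
Let HX1 : H 'X = a%:E.
Proof.
have E : gauss_dual (- a%:P) = 'X.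
  by rewrite /gauss_dual derivN derivC oppr0 sub0r -mul_polyC mulrN mulrN opprK
    mulrCA -polyCM mulVf ?gt_eqF// mulr1.
have := @integral0y_gauss_dual (- a%:P); rewrite E hornerN hornerC opprK => <-//.
by move=> x x0; rewrite hornerX.
Qed.

Let HX3 : H 'X^3 = (2 * a ^+ 2)%:E.
Proof.
pose p : {poly R} := - (a *: 'X^2 + (2 * a ^+ 2)%:P).
have E x : (gauss_dual p).[x] = x ^+ 3.
  rewrite /gauss_dual /p !(derivN, derivD, derivZ, derivXn, derivC) /=.
  rewrite !(hornerD, hornerN, hornerZ, hornerM, hornerX, hornerXn, hornerMn, hornerC).
  by rewrite as_; field; rewrite gt_eqF.
have -> : H 'X^3 = H (gauss_dual p).
  by apply: eq_integral => x _; rewrite E hornerXn.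
rewrite /H integral0y_gauss_dual => [|x x0]; last by rewrite E exprn_ge0.
by rewrite /p hornerN hornerD hornerZ hornerXn hornerC expr0n /= mulr0 add0r opprK.
Qed.

Let pospX n : posp 'X^n.
Proof. by move=> x x0; rewrite hornerXn exprn_ge0. Qed.

Let pospZ c p : 0 <= c -> posp p -> posp (c *: p).
Proof. by move=> c0 p0 x x0; rewrite hornerZ mulr_ge0// p0. Qed.

(* [1 - x^2/a + x^3/s^3 >= 0] on the half-line; the first two terms have the
   antiderivative [x g x], and the cubic term is there to make the integrand
   nonnegative, as the fundamental theorem of calculus on the half-line wants. *)
Let HX2 : H 'X^2 = (a%:E * H 1)%E.
Proof.
pose c := (s ^+ 3)^-1.
have c0 : 0 <= c by rewrite invr_ge0 exprn_ge0// ltW.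
pose p : {poly R} := 'X - c *: (a *: 'X^2 + (2 * a ^+ 2)%:P).
have E x : (gauss_dual p).[x] = 1 - a^-1 * x ^+ 2 + c * x ^+ 3.
  rewrite /gauss_dual /p !(derivB, derivD, derivZ, derivX, derivXn, derivC) /=.
  rewrite !(hornerD, hornerN, hornerZ, hornerM, hornerX, hornerXn, hornerMn, hornerC).
  by rewrite /c as_; field; rewrite gt_eqF.
have p0 : posp (gauss_dual p).
  move=> x x0; rewrite E as_; pose t := x / s.
  have t0 : 0 <= t by rewrite divr_ge0// ltW.
  have -> : 1 - (s ^+ 2)^-1 * x ^+ 2 + c * x ^+ 3 = 1 - t ^+ 2 + t ^+ 3.
    by rewrite /t /c; field; rewrite gt_eqF.
  by have [t1|/ltW t1] := leP t 1; nra.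
(* The negative term is moved across, since [H] is additive on nonnegative polynomials. The cubic
   term on the left and the boundary value of [p] on the right then contribute the same finite
   amount and cancel. *)
have : H (1 + c *: 'X^3) = H (a^-1 *: 'X^2 + gauss_dual p).
  apply: eq_integral => x _; congr ((_ * _)%:E).
  by rewrite hornerD [in RHS]hornerD E !hornerZ !hornerXn hornerC; ring.
have a10 : 0 <= a^-1 by rewrite invr_ge0 ltW.
have P1 : posp 1 by move=> x _; rewrite hornerC.
rewrite (HD P1 (pospZ c0 (pospX 3))) (HD (pospZ a10 (pospX 2)) p0).
rewrite (HZ c0 (pospX 3)) (HZ a10 (pospX 2)) HX3 {3}/H integral0y_gauss_dual//.
have -> : (- p.[0])%:E = (c%:E * (2 * a ^+ 2)%:E)%E.
  rewrite /p hornerD hornerN !(hornerD, hornerN, hornerZ, hornerXn, hornerX, hornerC).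
  by rewrite expr0n /= -EFinM; congr EFin; ring.
move=> /(congr1 (fun t => t - c%:E * (2 * a ^+ 2)%:E)%E); rewrite !addeK// => ->.
by rewrite muleA -EFinM divff ?gt_eqF// mul1e.
Qed.

(** Same scheme as for the square, with a linear correction. In [t = x / s] the integrand factor is
    [s^4 t (t^3 - 3 t + 2)], and the 2 in [c] produces the double root [(t - 1)^2 (t + 2)], hence
    nonnegativity. *)
Let HX4 : H 'X^4 = ((3 * a)%:E * H 'X^2)%E.
Proof.
pose c := 2 * s ^+ 3.
have c0 : 0 <= c by rewrite mulr_ge0// exprn_ge0// ltW.
pose p : {poly R} := - (a *: 'X^3 + (a * c)%:P).
have E x : (gauss_dual p).[x] = x ^+ 4 - 3 * a * x ^+ 2 + c * x.
  rewrite /gauss_dual /p !(derivN, derivD, derivZ, derivX, derivXn, derivC) /=.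
  rewrite !(hornerD, hornerN, hornerZ, hornerM, hornerX, hornerXn, hornerMn, hornerC).
  by rewrite /c as_; field; rewrite gt_eqF.
have p0 : posp (gauss_dual p).
  move=> x x0; rewrite E as_; pose t := x / s.
  have t0 : 0 <= t by rewrite divr_ge0// ltW.
  have -> : x ^+ 4 - 3 * s ^+ 2 * x ^+ 2 + c * x = s ^+ 4 * (t * (t ^+ 3 - 3 * t + 2)).
    by rewrite /t /c; field; rewrite gt_eqF.
  apply: mulr_ge0; first by rewrite exprn_ge0// ltW.
  apply: mulr_ge0 => //.
  have -> : t ^+ 3 - 3 * t + 2 = (t - 1) ^+ 2 * (t + 2) by ring.
  by rewrite mulr_ge0 ?sqr_ge0//; lra.
have : H ('X^4 + c *: 'X) = H ((3 * a) *: 'X^2 + gauss_dual p).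
  apply: eq_integral => x _; congr ((_ * _)%:E).
  by rewrite hornerD [in RHS]hornerD E !hornerZ !hornerXn hornerX; ring.
have a30 : 0 <= 3 * a by rewrite mulr_ge0// ltW.
have X0 : posp 'X by move=> x x0; rewrite hornerX.
rewrite (HD (pospX 4) (pospZ c0 X0)) (HD (pospZ a30 (pospX 2)) p0).
rewrite (HZ c0 X0) (HZ a30 (pospX 2)) HX1 {3}/H integral0y_gauss_dual//.
have -> : (- p.[0])%:E = (c%:E * a%:E)%E.
  rewrite /p hornerN !(hornerD, hornerN, hornerZ, hornerXn, hornerX, hornerC).
  by rewrite expr0n /= -EFinM; congr EFin; ring.
by move=> /(congr1 (fun t => t - c%:E * a%:E)%E); rewrite !addeK.
Qed.

(** Change of variables passes through the Radon-Nikodym derivative of [normal_prob], which agrees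
    with the density almost everywhere; evenness then folds the line onto the half-line. *)
Let integral_normalX n : ~~ odd n ->
  (\int[normal_prob 0 s]_x ((x : R) ^+ n)%:E = (2 * normal_peak s)%:E * H 'X^n)%E.
Proof.
move=> en.
have n0 (x : R) : 0 <= x ^+ n by exact: exprn_even_ge0.
have mX D : measurable D -> measurable_fun D (EFin \o (fun x : R => x ^+ n)).
  by move=> mD; apply/measurable_EFinP; apply: measurable_funTS; exact: measurable_funX.
have ndom := normal_prob_dominates 0 s.
rewrite -(Radon_Nikodym_SigmaFinite.change_of_variables ndom)//=; last exact: mX.
transitivity (\int[mu]_x ((x : R) ^+ n * normal_pdf 0 s x)%:E)%E.
  under [RHS]eq_integral do rewrite EFinM.
  apply: ae_eq_integral => //.
  - apply: emeasurable_funM; first exact: mX.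
    exact: (measurable_int _ (Radon_Nikodym_SigmaFinite.f_integrable ndom)).
  - apply: emeasurable_funM; first exact: mX.
    by apply/measurable_EFinP; exact: measurable_normal_pdf.
  - apply: ae_eqe_mul2l; apply: integral_ae_eq => //.
    + exact: Radon_Nikodym_SigmaFinite.f_integrable.
    + by apply/measurable_EFinP; exact: measurable_normal_pdf.
    + by move=> A _ mA; rewrite -Radon_Nikodym_SigmaFinite.f_integral.
transitivity (\int[mu]_x ((normal_peak s)%:E * (((x : R) ^+ n * g x)%R)%:E))%E.
  apply: eq_integral => x _; rewrite -EFinM normal_pdfE ?gt_eqF//; congr EFin.
  by rewrite mulrCA.
have cXg : continuous (fun x : R => x ^+ n * g x).
  move=> x; have := @continuous_poly_gauss 'X^n x.
  by under eq_fun do rewrite hornerXn.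
rewrite ge0_integralZl_EFin//; last 3 first.
- by move=> x _; rewrite lee_fin mulr_ge0// expR_ge0.
- by apply/measurable_EFinP; exact: continuous_measurable_fun.
- exact: normal_peak_ge0.
rewrite mulrC EFinM -muleA; congr (_ * _)%E.
rewrite ge0_symfun_integralT//; last 2 first.
- by move=> x; rewrite mulr_ge0// expR_ge0.
- move=> x /=; rewrite /normal_fun !subr0 sqrrN; congr (_ * _).
  by rewrite exprNn -signr_odd (negbTE en) mul1r.
congr (_ * _)%E; rewrite /H.
have <- : [set x : R | 0 <= x] = `[0, +oo[%classic.
  by apply/seteqP; split => x /=; rewrite in_itv /= andbT.
by apply: eq_integral => x _; rewrite hornerXn.
Qed.

Lemma normal_moments :
  (\int[normal_prob 0 s]_x ((x : R) ^+ 2)%:E = (s ^+ 2)%:E)%E /\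
  (\int[normal_prob 0 s]_x ((x : R) ^+ 4)%:E = (3 * s ^+ 4)%:E)%E.
Proof.
(* Total mass one stands in for the value of the Gaussian integral [H 1]. *)
have h0 : ((2 * normal_peak s)%:E * H 1 = 1)%E.
  rewrite -(integral_normalX (n := 0))//.
  under eq_integral do rewrite expr0.
  by rewrite integral_cst// mul1e; exact: probability_setT.
have h2 : (\int[normal_prob 0 s]_x ((x : R) ^+ 2)%:E = (s ^+ 2)%:E)%E.
  by rewrite integral_normalX// HX2 muleCA h0 mule1.
split=> //.
rewrite integral_normalX// HX4 muleCA -integral_normalX// h2 -EFinM.
by congr EFin; rewrite as_; ring.
Qed.

End GaussianMoments.

(** * Expectations of nonnegative functions, and moments read off a normal law *)

Section NonnegativeExpectation.
Context d (T : measurableType d) (R : realType) (P : probability T R).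

Definition nnmeasurable (f : T -> R) :=
  measurable_fun [set: T] f /\ forall x, 0 <= f x.

Definition expect (f : T -> R) : \bar R := (\int[P]_x (f x)%:E)%E.

Lemma nnmeasurableD f h : nnmeasurable f -> nnmeasurable h ->
  nnmeasurable (fun x => f x + h x).
Proof.
move=> [mf f0] [mh h0]; split; first exact: measurable_funD.
by move=> x; rewrite addr_ge0.
Qed.

Lemma nnmeasurableZ (c : R) f : 0 <= c -> nnmeasurable f ->
  nnmeasurable (fun x => c * f x).
Proof.
move=> c0 [mf f0]; split; first exact: measurable_funM.
by move=> x; rewrite mulr_ge0.
Qed.

Lemma nnmeasurable_cst (c : R) : 0 <= c -> nnmeasurable (fun=> c).
Proof. by move=> c0; split. Qed.

Lemma nnmeasurable_sum (I : Type) (r : seq I) (f : I -> T -> R) :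
  (forall i, nnmeasurable (f i)) -> nnmeasurable (fun x => \sum_(i <- r) f i x).
Proof.
move=> mf; split; last by move=> x; rewrite sumr_ge0// => i _; have [_] := mf i.
by apply: measurable_sum => i; have [] := mf i.
Qed.

Lemma nnmeasurable_even (f : T -> R) n : ~~ odd n -> measurable_fun [set: T] f ->
  nnmeasurable (fun x => f x ^+ n).
Proof.
by move=> en mf; split=> [|x]; [exact: measurable_funX|exact: exprn_even_ge0].
Qed.

Lemma expectD f h : nnmeasurable f -> nnmeasurable h ->
  expect (fun x => f x + h x) = (expect f + expect h)%E.
Proof.
move=> [mf f0] [mh h0]; rewrite /expect -ge0_integralD//.
- by move=> x _; rewrite lee_fin.
- exact/measurable_EFinP.
- by move=> x _; rewrite lee_fin.
- exact/measurable_EFinP.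
Qed.

Lemma expectZ (c : R) f : 0 <= c -> nnmeasurable f ->
  expect (fun x => c * f x) = (c%:E * expect f)%E.
Proof.
move=> c0 [mf f0]; rewrite /expect -ge0_integralZl_EFin//.
- by move=> x _; rewrite lee_fin.
- exact/measurable_EFinP.
Qed.

Lemma expect_cst (c : R) : expect (fun=> c) = c%:E.
Proof.
rewrite /expect integral_cst// -[RHS]mule1; congr (_ * _)%E.
exact: probability_setT.
Qed.

Lemma expect_sum (I : Type) (r : seq I) (f : I -> T -> R) :
  (forall i, nnmeasurable (f i)) ->
  expect (fun x => \sum_(i <- r) f i x) = (\sum_(i <- r) expect (f i))%E.
Proof.
move=> mf; elim: r => [|i r IH].
  by rewrite big_nil; apply: integral0_eq => x _; rewrite big_nil.
rewrite big_cons -IH -expectD//; last exact: nnmeasurable_sum.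
by apply: eq_integral => x _; rewrite big_cons.
Qed.

Lemma expect_le f h : nnmeasurable f -> nnmeasurable h -> (forall x, f x <= h x) ->
  (expect f <= expect h)%E.
Proof.
move=> [mf f0] [mh h0] fh; apply: ge0_le_integral => //.
- by move=> x _; rewrite lee_fin.
- exact/measurable_EFinP.
- exact/measurable_EFinP.
- by move=> x _; rewrite lee_fin.
Qed.

Lemma expect_ge0 f : nnmeasurable f -> (0 <= expect f)%E.
Proof. by move=> [mf f0]; apply: integral_ge0 => x _; rewrite lee_fin. Qed.

Lemma markov_expect f (c : R) (A : set T) : nnmeasurable f -> 0 < c ->
  measurable A -> (forall x, A x -> c <= f x) ->
  (P A <= (c^-1)%:E * expect f)%E.
Proof.
move=> nf c0 mA Af.
have c10 : 0 <= c^-1 by rewrite invr_ge0 ltW.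
rewrite -expectZ//.
have nI : nnmeasurable (\1_A : T -> R).
  by split; [exact: measurable_indic|move=> x; rewrite indicE].
have -> : P A = expect \1_A by rewrite /expect integral_indic// setIT.
apply: expect_le => //; first exact: nnmeasurableZ.
move=> x; rewrite indicE; have [xA|_] := boolP (x \in A); last first.
  by rewrite mulr_ge0//; case: nf.
by rewrite ler_pdivlMl// mulr1 Af//; exact: set_mem.
Qed.

(** The degenerate case [v = 0] does occur: polarization below takes differences of basis vectors
    that may be equal. The law of [W] is then a Dirac mass and both moments vanish. *)
Lemma normal_law_moments (W : T -> R) (v : R) : measurable_fun [set: T] W -> 0 <= v ->
  (forall A, measurable A -> pushforward P W A = normal_law 0 v A) ->
  expect (fun x => W x ^+ 2) = v%:E /\ expect (fun x => W x ^+ 4) = (3 * v ^+ 2)%:E.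
Proof.
move=> mW v0 hW.
pose W' : T -> measurableTypeR R := W.
have mW' : measurable_fun [set: T] W' by exact: mW.
pose mixin := isMeasurableFun.Build _ _ _ _ W' mW'.
pose Wp : {mfun T >-> measurableTypeR R} := HB.pack W' mixin.
have hWp A : measurable A -> pushforward P Wp A = normal_law 0 v A by exact: hW.
have mX n : measurable_fun [set: R] (EFin \o (fun y : R => y ^+ n)).
  by apply/measurable_EFinP; exact: measurable_funX.
have E n : ~~ odd n -> expect (fun x => W x ^+ n) =
    (\int[pushforward P Wp]_y ((y : R) ^+ n)%:E)%E.
  move=> en; rewrite ge0_integral_pushforward//; first exact: mX.
  by move=> y _; rewrite lee_fin exprn_even_ge0.
have [v00|vn0] := eqVneq v 0.
  have D n : (\int[pushforward P Wp]_y ((y : R) ^+ n)%:E)%E = ((0 : R) ^+ n)%:E.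
    rewrite (eq_measure_integral (\d_((0 : R) : measurableTypeR R))).
      by rewrite integral_dirac//= ?diracT ?mul1e//; exact: mX.
    by move=> A mA _; move: (hWp A mA); rewrite /normal_law v00 eqxx.
  by rewrite !E// !D v00 !expr0n mulr0.
have sv : 0 < Num.sqrt v by rewrite sqrtr_gt0 lt_def vn0.
have D n : (\int[pushforward P Wp]_y ((y : R) ^+ n)%:E)%E =
    (\int[normal_prob 0 (Num.sqrt v)]_y ((y : R) ^+ n)%:E)%E.
  apply: eq_measure_integral => A mA _.
  by move: (hWp A mA); rewrite /normal_law (negbTE vn0).
rewrite !E// !D; have [-> ->] := normal_moments sv.
by rewrite sqr_sqrtr// (exprM _ 2 2) sqr_sqrtr.
Qed.

End NonnegativeExpectation.

(** * The Frobenius norm as a uniform bound on quadratic forms *)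

Section FrobeniusNorm.
Variable R : realType.

Definition frob2 m n (A : 'M[R]_(m, n)) : R := \sum_i \sum_j A i j ^+ 2.

Lemma frob2_tr m n (A : 'M[R]_(m, n)) : frob2 A = \tr (A *m A^T).
Proof.
apply: eq_bigr => i _; rewrite mxE; apply: eq_bigr => j _.
by rewrite mxE expr2.
Qed.

(** Cauchy-Schwarz: the squared norm of [u - c v] equals [u'u - c^2]. *)
Lemma mform1_sqr_le k (u v : 'cV[R]_k) : mform 1%:M v v = 1 ->
  mform 1%:M u v ^+ 2 <= mform 1%:M u u.
Proof.
move=> v1; set c := mform 1%:M u v.
have := mform1_ge0 (u + (- c) *: v).
rewrite mformDl !mformDr !mformZl !mformZr (mform_sym v u) ?trmx1// v1 -/c; lra.
Qed.

Lemma frob2_mulmx_le m n (A : 'M[R]_(m, n)) (v : 'cV[R]_n) : mform 1%:M v v = 1 ->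
  mform 1%:M (A *m v) (A *m v) <= frob2 A.
Proof.
move=> v1; rewrite mform1E; apply: ler_sum => i _.
have := mform1_sqr_le (row i A)^T v1.
rewrite mform1E [leRHS]mform1E -expr2 mxE.
have -> : \sum_j (row i A)^T j 0 * v j 0 = \sum_j A i j * v j 0.
  by apply: eq_bigr => j _; rewrite !mxE.
by move=> h; apply: le_trans h _; apply: ler_sum => j _; rewrite !mxE expr2.
Qed.

Lemma mform_sqr_le k (A : 'M[R]_k) (v : 'cV[R]_k) : mform 1%:M v v = 1 ->
  mform A v v ^+ 2 <= frob2 A.
Proof.
move=> v1; apply: le_trans (frob2_mulmx_le A v1).
have -> : mform A v v = mform 1%:M (A *m v) v.
  by rewrite mform_sym ?trmx1// /mform mulmx1 mulmxA.
exact: mform1_sqr_le.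
Qed.

End FrobeniusNorm.

(** * Moments of linear and quadratic statistics of the error matrix *)

Section GaussianMatrix.
Context d (T : measurableType d) (R : realType) (P : probability T R).
Variables (n p : nat) (Sigma : 'M[R]_p) (E : T -> 'M[R]_(n, p)).
Hypothesis Sigma_sym : Sigma^T = Sigma.
Hypothesis Sigma_ge0 : forall v, 0 <= mform Sigma v v.
Hypothesis E_normal : multivariate_normal P (fun x => vec (E x)) 0 (Sigma *t 1%:M).

Let sum_unindex (F : 'I_p -> 'I_n -> R) :
  \sum_(k < p * n) F (mxtens_unindex k).1 (mxtens_unindex k).2 = \sum_j \sum_i F j i.
Proof.
rewrite pair_bigA /= (reindex (@mxtens_unindex p n))//=.
by exists (@mxtens_index p n) => k _; [exact: mxtens_unindexK|exact: mxtens_indexK].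
Qed.

Definition matrix_form (u : 'cV[R]_n) (v : 'cV[R]_p) (x : T) : R :=
  (u^T *m E x *m v) 0 0.

(** The Kronecker product of [v] and [u], in the index order of [vec]: it turns [u'Ev] into a linear
    form of [vec E], with variance [u'u] times [v' Sigma v]. *)
Let kron (u : 'cV[R]_n) (v : 'cV[R]_p) : 'cV[R]_(p * n) :=
  \col_k (v (mxtens_unindex k).1 0 * u (mxtens_unindex k).2 0).

Let matrix_formE u v x : matrix_form u v x = ((kron u v)^T *m vec (E x)) 0 0.
Proof.
rewrite mxE; under eq_bigr do rewrite !mxE.
rewrite (sum_unindex (fun j i => v j 0 * u i 0 * E x i j)) /matrix_form mxE.
apply: eq_bigr => j _; rewrite mxE mulr_suml; apply: eq_bigr => i _.
by rewrite mxE; ring.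
Qed.

Let kron_var u v :
  ((kron u v)^T *m (Sigma *t 1%:M) *m kron u v) 0 0 = mform 1%:M u u * mform Sigma v v.
Proof.
rewrite -[LHS]/(mform _ _ _) mformE.
under eq_bigr => k _ do under eq_bigr => k' _ do rewrite !mxE.
rewrite (sum_unindex (fun j i => \sum_k' v j 0 * u i 0 *
  (Sigma j (mxtens_unindex k').1 * (i == (mxtens_unindex k').2)%:R) *
  (v (mxtens_unindex k').1 0 * u (mxtens_unindex k').2 0))).
under eq_bigr => j _ do under eq_bigr => i _ do
  rewrite (sum_unindex (fun j' i' => v j 0 * u i 0 * (Sigma j j' * (i == i')%:R) *
    (v j' 0 * u i' 0))).
rewrite mform1E mformE mulrC mulr_suml; apply: eq_bigr => j _.
rewrite mulrC mulr_suml; apply: eq_bigr => i _.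
rewrite mulr_sumr; apply: eq_bigr => j' _.
rewrite (bigD1 i)//= eqxx big1 => [|i' ii']; last first.
  by rewrite eq_sym (negbTE ii') mulr0 mulr0 mul0r.
by rewrite mulr1n addr0; ring.
Qed.

Lemma measurable_matrix_form u v : measurable_fun [set: T] (matrix_form u v).
Proof.
have -> : matrix_form u v = fun x => \sum_k (kron u v) k 0 * vec (E x) k 0.
  by apply/funext => x; rewrite matrix_formE mxE; under eq_bigr do rewrite mxE.
apply: measurable_sum => k; apply: measurable_funM => //.
exact: (E_normal.1 k 0).
Qed.

Lemma matrix_form_moments u v (s := mform 1%:M u u * mform Sigma v v) :
  expect P (fun x => matrix_form u v x ^+ 2) = s%:E /\
  expect P (fun x => matrix_form u v x ^+ 4) = (3 * s ^+ 2)%:E.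
Proof.
apply: normal_law_moments; first exact: measurable_matrix_form.
  by rewrite mulr_ge0 ?mform1_ge0.
move=> A mA; have := E_normal.2 (kron u v) A mA; rewrite kron_var mulmx0 mxE => <-.
by congr (pushforward P _ A); apply/funext => x; rewrite matrix_formE.
Qed.

Let nn2 u v : nnmeasurable (fun x => matrix_form u v x ^+ 2).
Proof. by apply: nnmeasurable_even => //; exact: measurable_matrix_form. Qed.

Let nn4 u v : nnmeasurable (fun x => matrix_form u v x ^+ 4).
Proof. by apply: nnmeasurable_even => //; exact: measurable_matrix_form. Qed.

Let dl k (i : 'I_k) : 'cV[R]_k := delta_mx i 0.

Let mform_dl k (A : 'M[R]_k) i j : mform A (dl i) (dl j) = A i j := mform_delta A i j.

Lemma frob2_mulmxE m (U : 'M[R]_(m, n)) x :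
  frob2 (U *m E x) = \sum_i \sum_j matrix_form (row i U)^T (dl j) x ^+ 2.
Proof.
apply: eq_bigr => i _; apply: eq_bigr => j _; congr (_ ^+ 2).
by rewrite /matrix_form trmxK -row_mul -colE !mxE.
Qed.

Lemma nnmeasurable_frob2_mulmx m (U : 'M[R]_(m, n)) :
  nnmeasurable (fun x => frob2 (U *m E x)).
Proof.
have -> : (fun x => frob2 (U *m E x)) =
    fun x => \sum_i \sum_j matrix_form (row i U)^T (dl j) x ^+ 2.
  by apply/funext => x; exact: frob2_mulmxE.
by apply: nnmeasurable_sum => i; apply: nnmeasurable_sum => j; exact: nn2.
Qed.

Lemma expect_frob2_mulmx m (U : 'M[R]_(m, n)) :
  expect P (fun x => frob2 (U *m E x)) = (frob2 U * \tr Sigma)%:E.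
Proof.
transitivity (expect P (fun x => \sum_i \sum_j matrix_form (row i U)^T (dl j) x ^+ 2)).
  by congr (expect P _); apply/funext => x; exact: frob2_mulmxE.
rewrite expect_sum; last by move=> i; apply: nnmeasurable_sum => j; exact: nn2.
rewrite /frob2 mulr_suml -sumEFin; apply: eq_bigr => i _.
rewrite expect_sum; last by move=> j; exact: nn2.
rewrite /mxtrace mulr_sumr -sumEFin; apply: eq_bigr => j _.
have [-> _] := matrix_form_moments (row i U)^T (dl j).
rewrite mform_dl mform1E; congr ((_ * _)%:E).
by apply: eq_bigr => k _; rewrite !mxE expr2.
Qed.

(* Mixed fourth moments by polarization of fourth powers of linear forms, which
   avoids deriving independence from the laws of linear forms. *)
Let expect_sqr_sqr i j v (s := mform Sigma v v) :
  expect P (fun x => matrix_form (dl i) v x ^+ 2 * matrix_form (dl j) v x ^+ 2) =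
  (s ^+ 2 * (1 + 2 * (i == j)%:R))%:E.
Proof.
set z := fun i => matrix_form (dl i) v.
have nnz : nnmeasurable (fun x => z i x ^+ 2 * z j x ^+ 2).
  have [m1 p1] := nn2 (dl i) v; have [m2 p2] := nn2 (dl j) v.
  by split=> [|x]; [exact: measurable_funM|exact: mulr_ge0 (p1 x) (p2 x)].
have N (e : R) : e ^+ 2 = 1 ->
    mform 1%:M (dl i + e *: dl j) (dl i + e *: dl j) = 2 + 2 * e * (i == j)%:R.
  move=> e1; rewrite mformDl !mformDr !mformZl !mformZr !mform_dl !mxE !eqxx.
  rewrite (eq_sym j i) !mulr1n mulr1 -expr2 e1; case: (i == j); rewrite ?mulr1n ?mulr0n; ring.
have M (e : R) : e ^+ 2 = 1 ->
    expect P (fun x => matrix_form (dl i + e *: dl j) v x ^+ 4) =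
    (3 * ((2 + 2 * e * (i == j)%:R) * s) ^+ 2)%:E.
  by move=> e1; have [_ ->] := matrix_form_moments (dl i + e *: dl j) v; rewrite N.
have Z k : expect P (fun x => z k x ^+ 4) = (3 * s ^+ 2)%:E.
  by have [_ ->] := matrix_form_moments (dl k) v; rewrite mform_dl mxE eqxx mul1r.
(* The identity [(a + b)^4 + (a - b)^4 = 12 a^2 b^2 + 2 a^4 + 2 b^4]. *)
have : expect P (fun x => 12 * (z i x ^+ 2 * z j x ^+ 2) + 2 * z i x ^+ 4 + 2 * z j x ^+ 4) =
    expect P (fun x => matrix_form (dl i + 1 *: dl j) v x ^+ 4 +
                       matrix_form (dl i + -1 *: dl j) v x ^+ 4).
  congr (expect P _); apply/funext => x.
  have zD e : matrix_form (dl i + e *: dl j) v x = z i x + e * z j x.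
    by rewrite /z /matrix_form linearD /= linearZ /= !mulmxDl -!scalemxAl !mxE.
  by rewrite !zD; ring.
have nnc (c : R) f : 0 <= c -> nnmeasurable f -> nnmeasurable (fun x : T => c * f x).
  exact: nnmeasurableZ.
rewrite [RHS]expectD; [|exact: nn4|exact: nn4].
rewrite (M 1) ?expr1n// (M (-1)) ?sqrrN ?expr1n//.
rewrite expectD; last 2 first.
- by apply: nnmeasurableD; apply: nnc => //; exact: nn4.
- by apply: nnc => //; exact: nn4.
rewrite expectD; last 2 first.
- exact: nnc.
- by apply: nnc => //; exact: nn4.
rewrite !expectZ//; [|exact: nn4|exact: nn4].
(* An infinite mixed moment would contradict the finite right-hand side; for a finite one the
   equation is linear over the reals. *)
rewrite !Z; have := expect_ge0 P nnz; case: (expect P _) => [r _| _|]//; last first.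
  by rewrite gt0_muley// ?lte_fin// -!EFinM.
rewrite -!EFinM -!EFinD => -[h]; congr EFin.
by case: (i == j) h => /=; rewrite ?mulr1 ?mulr0; lra.
Qed.

(** The squared norm of [E v] minus its mean, written as a quadratic form so that polarization
    recovers the matrix entries. *)
Definition norm_excess v x : R := mform (((E x)^T *m E x) - n%:R *: Sigma) v v.

Let norm_excessE v x :
  norm_excess v x = \sum_i matrix_form (dl i) v x ^+ 2 - n%:R * mform Sigma v v.
Proof.
rewrite /norm_excess mformBm mformZm; congr (_ - _).
have -> : mform ((E x)^T *m E x) v v = mform 1%:M (E x *m v) (E x *m v).
  by rewrite /mform mulmx1 trmx_mul !mulmxA.
rewrite mform1E; apply: eq_bigr => i _; rewrite -expr2; congr (_ ^+ 2).
by rewrite /matrix_form trmx_delta -mulmxA -rowE [RHS]mxE.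
Qed.

Lemma measurable_norm_excess v : measurable_fun [set: T] (norm_excess v).
Proof.
have -> : norm_excess v =
    fun x => \sum_i matrix_form (dl i) v x ^+ 2 - n%:R * mform Sigma v v.
  by apply/funext => x; exact: norm_excessE.
by apply: measurable_funB => //; apply: measurable_sum => i; have [] := nn2 (dl i) v.
Qed.

(** This is the variance of [s] times a chi-square variable with [n] degrees of freedom, obtained
    from the mixed fourth moments alone. *)
Lemma expect_norm_excess2 v :
  expect P (fun x => norm_excess v x ^+ 2) = (2 * n%:R * mform Sigma v v ^+ 2)%:E.
Proof.
set s := mform Sigma v v; pose z i := matrix_form (dl i) v.
have nnz i : nnmeasurable (fun x => z i x ^+ 2) by exact: nn2.
have nnzz i j : nnmeasurable (fun x => z i x ^+ 2 * z j x ^+ 2).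
  have [m1 p1] := nnz i; have [m2 p2] := nnz j.
  by split=> [|x]; [exact: measurable_funM|rewrite mulr_ge0].
have nnF : nnmeasurable (fun x => norm_excess v x ^+ 2).
  by apply: nnmeasurable_even => //; exact: measurable_norm_excess.
have s0 : 0 <= s by exact: Sigma_ge0.
have ns0 : 0 <= 2 * n%:R * s by rewrite !mulr_ge0.
(* With [Q] the sum of squares, [(Q - n s)^2 + 2 n s Q = Q^2 + (n s)^2] has only nonnegative
   terms. *)
have : expect P (fun x => norm_excess v x ^+ 2 + 2 * n%:R * s * \sum_i z i x ^+ 2) =
    expect P (fun x => \sum_i \sum_j (z i x ^+ 2 * z j x ^+ 2) + (n%:R * s) ^+ 2).
  congr (expect P _); apply/funext => x.
  have -> : \sum_i \sum_j (z i x ^+ 2 * z j x ^+ 2) = (\sum_i z i x ^+ 2) ^+ 2.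
    by rewrite expr2 mulr_suml; apply: eq_bigr => i _; rewrite mulr_sumr.
  by rewrite norm_excessE -/s; ring.
rewrite expectD//; last by apply: nnmeasurableZ => //; exact: nnmeasurable_sum.
rewrite expectZ//; last exact: nnmeasurable_sum.
rewrite expectD; last 2 first.
- by apply: nnmeasurable_sum => i; exact: nnmeasurable_sum.
- by apply: nnmeasurable_cst; rewrite sqr_ge0.
rewrite expect_cst expect_sum//.
have -> : (\sum_i expect P (fun x => (z i x ^+ 2)%R))%E = (n%:R * s)%:E.
  rewrite (eq_bigr (fun=> s%:E)) => [|i _].
    by rewrite sumEFin sumr_const card_ord mulr_natl.
  by have [-> _] := matrix_form_moments (dl i) v; rewrite mform_dl mxE eqxx mul1r.
rewrite expect_sum; last by move=> i; exact: nnmeasurable_sum.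
have -> : (\sum_i expect P (fun x => (\sum_j z i x ^+ 2 * z j x ^+ 2)%R))%E =
    (s ^+ 2 * (n%:R ^+ 2 + 2 * n%:R))%:E.
  rewrite (eq_bigr (fun=> (s ^+ 2 * (n%:R + 2))%:E)) => [|i _].
    by rewrite sumEFin sumr_const card_ord -mulr_natl; congr EFin; ring.
  rewrite expect_sum// (eq_bigr (fun j => (s ^+ 2 * (1 + 2 * (i == j)%:R))%:E)).
    rewrite sumEFin -mulr_sumr big_split /= sumr_const card_ord -mulr_sumr.
    rewrite (bigD1 i)//= eqxx big1 => [|j ji]; last by rewrite eq_sym (negbTE ji).
    by rewrite addr0 mulr1.
  by move=> j _; exact: expect_sqr_sqr.
have := expect_ge0 P nnF; case: (expect P _) => [r _| |]//=.
by rewrite -!EFinM -!EFinD => -[h]; congr EFin; lra.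
Qed.

Let Gram x := (E x)^T *m E x - n%:R *: Sigma.

Let Gram_polarized x j k :
  Gram x j k = (norm_excess (dl j + dl k) x - norm_excess (dl j - dl k) x) / 4.
Proof.
have sG : (Gram x)^T = Gram x.
  by rewrite /Gram linearB /= linearZ /= Sigma_sym trmx_mul trmxK.
rewrite /norm_excess -/(Gram x) -(scaleN1r (dl k)) !(mformDl, mformDr).
rewrite !mformZl !mformZr (mform_sym (dl k) (dl j))// !mform_dl; by field.
Qed.

Lemma nnmeasurable_frob2_gram :
  nnmeasurable (fun x => frob2 ((E x)^T *m E x - n%:R *: Sigma)).
Proof.
apply: nnmeasurable_sum => j; apply: nnmeasurable_sum => k.
apply: nnmeasurable_even => //.
rewrite (_ : (fun x => _) = fun x =>
  (norm_excess (dl j + dl k) x - norm_excess (dl j - dl k) x) / 4); last first.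
  by apply/funext => x; rewrite -Gram_polarized.
apply: measurable_funM => //; apply: measurable_funB; exact: measurable_norm_excess.
Qed.

(** By polarization a squared entry is at most [(a^2 + b^2) / 8], with [a] and [b] the excesses at
    [e_j + e_k] and [e_j - e_k]. The two values of the form of [Sigma] there are nonnegative with
    sum at most [4 tr Sigma], so each of the [p^2] entries contributes at most
    [4 n (tr Sigma)^2]. *)
Lemma expect_frob2_gram :
  (expect P (fun x => frob2 ((E x)^T *m E x - n%:R *: Sigma)) <=
   (4 * p%:R ^+ 2 * n%:R * \tr Sigma ^+ 2)%:E)%E.
Proof.
have diag_ge0 j : 0 <= Sigma j j by rewrite -mform_dl.
have diag_le j : Sigma j j <= \tr Sigma.
  by rewrite /mxtrace (bigD1 j)//= lerDl sumr_ge0.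
have nnF v : nnmeasurable (fun x => norm_excess v x ^+ 2).
  by apply: nnmeasurable_even => //; exact: measurable_norm_excess.
pose f j k x := 8^-1 * (norm_excess (dl j + dl k) x ^+ 2 + norm_excess (dl j - dl k) x ^+ 2).
have nnf j k : nnmeasurable (f j k).
  by apply: nnmeasurableZ => //; exact: nnmeasurableD.
apply: (@le_trans _ _ (expect P (fun x => \sum_j \sum_k f j k x))).
  apply: expect_le; first exact: nnmeasurable_frob2_gram.
    by apply: nnmeasurable_sum => j; exact: nnmeasurable_sum.
  move=> x; apply: ler_sum => j _; apply: ler_sum => k _.
  rewrite -/(Gram x) Gram_polarized /f.
  set a := norm_excess _ x; set b := norm_excess _ x.
  by have := sqr_ge0 (a + b); rewrite sqrrD expr_div_n sqrrB; lra.
rewrite expect_sum; last by move=> j; exact: nnmeasurable_sum.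
have -> : 4 * p%:R ^+ 2 * n%:R * \tr Sigma ^+ 2 =
    \sum_(j < p) \sum_(k < p) (4 * n%:R * \tr Sigma ^+ 2).
  by rewrite !sumr_const !card_ord -mulrnA -[RHS]mulr_natl natrM; ring.
rewrite -sumEFin; apply: lee_sum => j _.
rewrite expect_sum// -sumEFin; apply: lee_sum => k _.
rewrite expectZ//; last exact: nnmeasurableD.
rewrite expectD// !expect_norm_excess2 -EFinD -EFinM lee_fin.
have := Sigma_ge0 (dl j + dl k); have := Sigma_ge0 (dl j - dl k).
set a := mform Sigma _ _ => a0; set b := mform Sigma _ _ => b0.
have ab : a + b <= 4 * \tr Sigma.
  rewrite /a /b -(scaleN1r (dl k)) !(mformDl, mformDr).
  rewrite !mformZl !mformZr !mform_dl.
  by have := diag_le j; have := diag_le k; lra.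
have : a ^+ 2 + b ^+ 2 <= 16 * \tr Sigma ^+ 2 by nra.
have : (0 : R) <= n%:R by [].
set N : R := n%:R; set t := \tr Sigma ^+ 2 => N0 h.
have -> : 8^-1 * (2 * N * b ^+ 2 + 2 * N * a ^+ 2) = N * ((a ^+ 2 + b ^+ 2) / 4) by field.
by have := ler_wpM2l N0 h; lra.
Qed.

End GaussianMatrix.

(** * The hat matrix and the quadratic form of [S_w] *)

Section Regression.
Variable R : realType.

Lemma frob2_eq0 m n (A : 'M[R]_(m, n)) : frob2 A = 0 -> A = 0.
Proof.
move=> /eqP; rewrite psumr_eq0 => [/allP h|i _]; last first.
  by apply: sumr_ge0 => j _; rewrite sqr_ge0.
apply/matrixP => i j; rewrite mxE; apply/eqP.
have /eqP := h i (mem_index_enum _); rewrite /= => /eqP.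
rewrite psumr_eq0 => [/allP /(_ j (mem_index_enum _))|k _]; last by rewrite sqr_ge0.
by rewrite /= sqrf_eq0.
Qed.

Section Projection.
Variables (n q : nat) (X : 'M[R]_(n, q)).
Hypothesis rankX : \rank X = q.
Local Notation H := (hat_mx X).

(** If [K X'X = 0], the squared Frobenius norm of [K X'] is [tr (K X'X K') = 0], and full rank of
    [X] then gives [K = 0]. *)
Lemma gram_unitmx : X^T *m X \in unitmx.
Proof.
rewrite -row_free_unit -kermx_eq0; set K := kermx _.
have freeXT : row_free X^T by rewrite /row_free mxrank_tr rankX.
have : K *m X^T = 0.
  apply: frob2_eq0; rewrite frob2_tr trmx_mul trmxK mulmxA -(mulmxA K).
  by rewrite mulmx_ker mul0mx mxtrace0.
by move=> /eqP; rewrite mulmx_free_eq0.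
Qed.

Lemma hat_mx_sym : H^T = H.
Proof. by rewrite /hat_mx !trmx_mul trmxK trmx_inv trmx_mul trmxK mulmxA. Qed.

Lemma hat_mxX : H *m X = X.
Proof. by rewrite /hat_mx -!mulmxA mulVmx ?gram_unitmx// mulmx1. Qed.

Lemma hat_mx_idem : H *m H = H.
Proof. by rewrite {2}/hat_mx !mulmxA hat_mxX. Qed.

(** For a symmetric idempotent this is the trace. It does not grow with [n], so the projected noise
    stays bounded in mean. *)
Lemma frob2_hat_mx : frob2 H = q%:R.
Proof.
rewrite frob2_tr hat_mx_sym hat_mx_idem /hat_mx mxtrace_mulC mulmxA.
by rewrite mulmxV ?gram_unitmx// mxtrace1.
Qed.

End Projection.

Lemma mform_tr_mul n p (Y : 'M[R]_(n, p)) (A : 'M[R]_n) v :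
  mform (Y^T *m A *m Y) v v = mform A (Y *m v) (Y *m v).
Proof. by rewrite /mform trmx_mul !mulmxA. Qed.

Lemma S_w_sym n p q (w : R) (X : 'M[R]_(n, q)) (Y : 'M[R]_(n, p)) :
  (S_w w X Y)^T = S_w w X Y.
Proof.
have Q (A : 'M[R]_n) : A^T = A -> (Y^T *m A *m Y)^T = Y^T *m A *m Y.
  by move=> sA; rewrite !trmx_mul trmxK sA mulmxA.
rewrite /S_w /S_R /S_E linearD /= linearZ [X in _ + X]linearZ /= !Q ?hat_mx_sym//.
rewrite linearB /= hat_mx_sym linearB /= linearZ /= trmx1.
by rewrite (trmx_mul (ones n)) trmxK.
Qed.

(** [Y v] is a multiple of [ones n], plus [s X alpha], plus [Z v]. The hat matrix kills the first
    and fixes the second, so the intercept drops out of both scatter matrices and the signal drops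
    out of [S_E]. *)
Lemma mform_S_w n p q (w : R) (X : 'M[R]_(n, q)) (mu g : 'cV[R]_p)
    (alpha : 'cV[R]_q) (Z Y : 'M[R]_(n, p)) (v : 'cV[R]_p) :
  (0 < n)%N -> \rank X = q -> X^T *m ones n = 0 ->
  Y = ones n *m mu^T + X *m alpha *m g^T + Z ->
  let c := mform 1%:M (X *m alpha) (X *m alpha) in
  let s := mform 1%:M g v in
  let b := mform 1%:M (X *m alpha) (Z *m v) in
  let h := mform 1%:M (hat_mx X *m Z *m v) (hat_mx X *m Z *m v) in
  mform (S_w w X Y) v v = (1 - w) * (c * s ^+ 2 + 2 * s * b + h) +
    w * (mform 1%:M (Z *m v) (Z *m v) - n%:R^-1 * mform 1%:M (ones n) (Z *m v) ^+ 2 - h).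
Proof.
move=> n0 rX X1 YE c s b h; set e := Z *m v in b *.
have nn0 : n%:R != 0 :> R by rewrite pnatr_eq0 -lt0n.
set xa := X *m alpha in c b YE *; set o := ones n : 'cV[R]_n in X1 YE *.
pose a := mform 1%:M mu v.
have yE : Y *m v = a *: o + (s *: xa + e).
  rewrite YE !mulmxDl addrA -/e; congr (_ + _ + _).
    rewrite -mulmxA [_ *m v]mx11_scalar mul_mx_scalar; congr (_ *: _).
    by rewrite /a /mform mulmx1.
  rewrite -mulmxA [_ *m v]mx11_scalar mul_mx_scalar; congr (_ *: _).
  by rewrite /s /mform mulmx1.
have Ho : hat_mx X *m o = 0 by rewrite /hat_mx -mulmxA X1 mulmx0.
have Hxa : hat_mx X *m xa = xa by rewrite /xa mulmxA hat_mxX.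
have sH := hat_mx_sym X; have s1 : (1%:M : 'M[R]_n)^T = 1%:M by rewrite trmx1.
have Hl u z : mform (hat_mx X) u z = mform 1%:M (hat_mx X *m u) z.
  by rewrite /mform mulmx1 trmx_mul sH.
have Hoz z : mform (hat_mx X) o z = 0 by rewrite Hl Ho /mform trmx0 !mul0mx mxE.
have Hxz z : mform (hat_mx X) xa z = mform 1%:M xa z by rewrite Hl Hxa.
have Hee : mform (hat_mx X) e e = h.
  have -> : h = mform 1%:M (hat_mx X *m e) (hat_mx X *m e) by rewrite /h mulmxA.
  by rewrite -Hl (mform_sym _ _ sH) [in RHS]Hl mulmxA hat_mx_idem// -Hl.
have oo : mform 1%:M o o = n%:R.
  rewrite mform1E (eq_bigr (fun=> 1)) => [|i _]; last by rewrite !mxE mulr1.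
  by rewrite sumr_const card_ord.
have oxa : mform 1%:M o xa = 0.
  by rewrite mform_sym// /mform mulmx1 /xa trmx_mul -mulmxA X1 mulmx0 mxE.
rewrite /S_w mformDm !mformZm /S_R /S_E !mform_tr_mul yE.
rewrite !mformBm !mformZm mform_rank1 !(mformDl, mformDr) !(mformZl, mformZr).
rewrite (mform_sym xa o sH) (mform_sym e o sH) (mform_sym e xa sH) !Hoz !Hxz Hee.
rewrite (mform_sym xa o s1) (mform_sym e o s1) (mform_sym e xa s1) oo oxa -/c -/b.
by field.
Qed.

End Regression.

(** * A tail bound for fixed [n] *)

Section FiniteSample.
Context d (T : measurableType d) (R : realType) (P : probability T R).
Variables (n p q : nat) (w : R) (X : 'M[R]_(n, q)) (mu : 'cV[R]_p) (alpha : 'cV[R]_q).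
Variables (Sigma : 'M[R]_p) (lam : p.-tuple R) (g : 'cV[R]_p) (E Y : T -> 'M[R]_(n, p)).
Hypothesis w01 : 0 <= w <= 1.
Hypothesis n_gt0 : (0 < n)%N.
Hypothesis p_ge2 : (2 <= p)%N.
Hypothesis model : allometric_regression P X mu alpha Sigma lam g E Y.

Let xa := X *m alpha.
Let c := n%:R^-1 * mform 1%:M xa xa.
Let r := Num.sqrt n%:R : R.
(** The mean of [W] in units of [r]: [3 / 2] collects the two bare [r] terms, and the bounded terms
    [(q + 1) tr Sigma] are absorbed using [r >= 1]. *)
Let K := 3 / 2 + (c + q%:R + 1) * \tr Sigma + 2 * p%:R ^+ 2 * \tr Sigma ^+ 2.
Let gap := (1 - w) * c + w * (lam`_0 - lam`_1).

Let n0 : 0 < n%:R :> R. Proof. by rewrite ltr0n. Qed.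
Let r0 : 0 < r. Proof. by rewrite sqrtr_gt0. Qed.
Let rr : r ^+ 2 = n%:R. Proof. by rewrite sqr_sqrtr// ltW. Qed.
Let r1 : 1 <= r. Proof. by rewrite -sqrtr1 ler_wsqrtr// ler1n. Qed.
Let c_ge0 : 0 <= c. Proof. by rewrite mulr_ge0 ?mform1_ge0// invr_ge0 ltW. Qed.
Let sS : Sigma^T = Sigma. Proof. by case: (Sigma_posdef model). Qed.

Let S_ge0 v : 0 <= mform Sigma v v.
Proof. exact/posdef_mform_ge0/(Sigma_posdef model). Qed.

Let tr_ge0 : 0 <= \tr Sigma.
Proof. exact/posdef_trace_ge0/(Sigma_posdef model). Qed.

(** A bound on the noise form that does not involve the unit vector: in order, the signal-noise
    cross term, the projected noise, the noise mean, and the deviation of [E'E] from [n Sigma]. *)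
Let W x := r + r^-1 * frob2 (xa^T *m E x) + frob2 (hat_mx X *m E x) +
  n%:R^-1 * frob2 ((ones n)^T *m E x) +
  2^-1 * (r^-1 * frob2 ((E x)^T *m E x - n%:R *: Sigma) + r).

(** [n] times the noiseless matrix; its gap is therefore [n * gap]. *)
Let A := ((1 - w) * (n%:R * c)) *: (g *m g^T) + (w * n%:R) *: Sigma.

Let ncE : n%:R * c = mform 1%:M xa xa.
Proof. by rewrite mulrA mulfV ?mul1r// gt_eqF. Qed.

Let mform_noise_le x v : mform 1%:M v v = 1 -> `|mform (S_w w X (Y x) - A) v v| <= W x.
Proof.
move=> v1; rewrite mformBm.
rewrite (mform_S_w w v n_gt0 (design_rank model) (design_centered model) (responseE model x)).
rewrite /A mformDm !mformZm mform_rank1 ncE -/xa.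
set s := mform 1%:M g v; set C := mform 1%:M xa xa.
set b := mform 1%:M xa _; set h := mform 1%:M _ _; set o := mform 1%:M (ones n) _.
have s1 : s ^+ 2 <= 1.
  by rewrite -(enorm1 (gamma1_unit model)); exact: mform1_sqr_le.
have b1 : b ^+ 2 <= frob2 (xa^T *m E x).
  apply: le_trans (frob2_mulmx_le _ v1); rewrite mform1E big_ord1 -expr2.
  by rewrite /b /mform mulmx1 mulmxA.
have o1 : o ^+ 2 <= frob2 ((ones n)^T *m E x).
  apply: le_trans (frob2_mulmx_le _ v1); rewrite mform1E big_ord1 -expr2.
  by rewrite /o /mform mulmx1 mulmxA.
have h1 : h <= frob2 (hat_mx X *m E x) by exact: frob2_mulmx_le.
have h0 : 0 <= h by exact: mform1_ge0.
have := mform_sqr_le ((E x)^T *m E x - n%:R *: Sigma) v1.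
rewrite mformBm mformZm.
have -> : mform ((E x)^T *m E x) v v = mform 1%:M (E x *m v) (E x *m v).
  by rewrite /mform mulmx1 trmx_mul !mulmxA.
set e := mform 1%:M _ _; set S := mform Sigma v v => F1.
have /andP[w0 w1] := w01.
(* The weight [r = sqrt n] balances the two terms, because [z] has mean of order [n] in both
   uses. *)
have amgm (y z : R) : y ^+ 2 <= z -> `|y| <= 2^-1 * (r^-1 * z + r).
  move=> yz; rewrite -(ler_pM2l r0) mulrC.
  have -> : r * (2^-1 * (r^-1 * z + r)) = 2^-1 * (z + r ^+ 2) by field; rewrite gt_eqF.
  by have := sqr_ge0 (`|y| - r); rewrite sqrrB real_normK ?num_real//; lra.
have B := amgm _ _ b1; have F := amgm _ _ F1.
have sB : `|s * b| <= `|b|.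
  rewrite normrM ler_piMl// -(@ler_pXn2r _ 2%N) ?nnegrE// expr1n.
  by rewrite real_normK ?num_real.
have o2 : n%:R^-1 * o ^+ 2 <= n%:R^-1 * frob2 ((ones n)^T *m E x).
  by rewrite ler_wpM2l// invr_ge0 ltW.
have o0 : 0 <= n%:R^-1 * o ^+ 2 by rewrite mulr_ge0 ?sqr_ge0// invr_ge0 ltW.
(* The pure signal term cancels against [A]; [h] enters with both signs, whence the coefficient
   [1 - 2 w], of modulus at most 1. *)
rewrite (_ : _ - _ = 2 * ((1 - w) * (s * b)) + (1 - 2 * w) * h - w * (n%:R^-1 * o ^+ 2)
  + w * (e - n%:R * S)); last by ring.
have t1 : `|2 * ((1 - w) * (s * b))| <= 2 * `|b|.
  rewrite normrM ger0_norm// ler_pM2l// normrM (ger0_norm (_ : 0 <= 1 - w)) ?subr_ge0//.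
  by apply: le_trans sB; rewrite ler_piMl//; lra.
have t2 : `|(1 - 2 * w) * h| <= h.
  by rewrite normrM (ger0_norm h0) ler_piMl// ler_norml; lra.
have t3 : `|w * (n%:R^-1 * o ^+ 2)| <= n%:R^-1 * o ^+ 2.
  by rewrite normrM (ger0_norm o0) (ger0_norm w0) ler_piMl.
have t4 : `|w * (e - n%:R * S)| <= `|e - n%:R * S|.
  by rewrite normrM (ger0_norm w0) ler_piMl.
rewrite /W; apply: le_trans (ler_normD _ _) _; apply: le_trans (lerD (ler_normB _ _) t4) _.
apply: le_trans (lerD (lerD (ler_normD _ _) t3) (lexx _)) _.
by apply: le_trans (lerD (lerD (lerD t1 t2) (lexx _)) F) _; lra.
Qed.

Let nnW : nnmeasurable W.
Proof.
have En := error_normal model.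
have r10 : 0 <= r^-1 by rewrite invr_ge0 ltW.
have n10 : 0 <= n%:R^-1 :> R by rewrite invr_ge0 ltW.
have nU m (U : 'M[R]_(m, n)) := nnmeasurable_frob2_mulmx En U.
have nG := nnmeasurable_frob2_gram sS En.
have hc : nnmeasurable (fun _ : T => r) by apply: nnmeasurable_cst; rewrite ltW.
rewrite /W; apply: nnmeasurableD.
  apply: nnmeasurableD; last exact: nnmeasurableZ n10 (nU _ _).
  apply: nnmeasurableD (nU _ _); apply: nnmeasurableD => //.
  exact: nnmeasurableZ r10 (nU _ _).
apply: nnmeasurableZ => //; apply: nnmeasurableD => //.
exact: nnmeasurableZ r10 nG.
Qed.

Let expectW : (expect P W <= (r * K)%:E)%E.
Proof.
have En := error_normal model.
have r10 : 0 <= r^-1 by rewrite invr_ge0 ltW.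
have n10 : 0 <= n%:R^-1 :> R by rewrite invr_ge0 ltW.
have nU m (U : 'M[R]_(m, n)) := nnmeasurable_frob2_mulmx En U.
have nG := nnmeasurable_frob2_gram sS En.
have hc : nnmeasurable (fun _ : T => r) by apply: nnmeasurable_cst; rewrite ltW.
have n1 := nnmeasurableZ r10 (nU _ xa^T).
have n2 := nU _ (hat_mx X).
have n3 := nnmeasurableZ n10 (nU _ (ones n)^T).
have n4 := nnmeasurableZ r10 nG.
have half0 : 0 <= 2^-1 :> R by rewrite invr_ge0.
rewrite /W (expectD _ (nnmeasurableD (nnmeasurableD (nnmeasurableD hc n1) n2) n3)
  (nnmeasurableZ half0 (nnmeasurableD n4 hc))).
rewrite (expectD _ (nnmeasurableD (nnmeasurableD hc n1) n2) n3).
rewrite (expectD _ (nnmeasurableD hc n1) n2) (expectD _ hc n1).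
rewrite (expectZ _ half0 (nnmeasurableD n4 hc)) (expectD _ n4 hc).
rewrite (expectZ _ r10 (nU _ _)) (expectZ _ n10 (nU _ _)) (expectZ _ r10 nG).
rewrite !(expect_frob2_mulmx S_ge0 En) !expect_cst frob2_hat_mx ?(design_rank model)//.
have -> : frob2 xa^T = n%:R * c.
  by rewrite ncE mform1E /frob2 big_ord1; apply: eq_bigr => i _; rewrite mxE expr2.
have -> : frob2 ((ones n)^T : 'M[R]_(1, n)) = n%:R.
  rewrite /frob2 big_ord1 (eq_bigr (fun=> 1)) => [|i _]; last by rewrite !mxE expr1n.
  by rewrite sumr_const card_ord.
apply: (@le_trans _ _ (r%:E + (r^-1)%:E * (n%:R * c * \tr Sigma)%:E + (q%:R * \tr Sigma)%:E +
   (n%:R^-1)%:E * (n%:R * \tr Sigma)%:E +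
   (2^-1)%:E * ((r^-1)%:E * (4 * p%:R ^+ 2 * n%:R * \tr Sigma ^+ 2)%:E + r%:E))%E).
  apply: leeD => //; apply: lee_wpmul2l; first by rewrite lee_fin.
  apply: leeD => //; apply: lee_wpmul2l; first by rewrite lee_fin.
  exact: expect_frob2_gram.
do 4 rewrite -?EFinM -?EFinD; rewrite lee_fin -rr /K.
have := tr_ge0; set t := \tr Sigma => t0.
set B := 3 / 2 + c * t + 2 * p%:R ^+ 2 * t ^+ 2.
apply: (@le_trans _ _ (r * B + (q%:R + 1) * t)).
  by rewrite le_eqVlt; apply/orP; left; apply/eqP; rewrite /B; field; rewrite gt_eqF.
apply: (@le_trans _ _ (r * B + r * ((q%:R + 1) * t))); last first.
  by rewrite le_eqVlt; apply/orP; left; apply/eqP; rewrite /B; ring.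
by rewrite lerD2l ler_peMl// mulr_ge0.
Qed.

Lemma sign_dist_tail_bound (ghat : T -> 'cV[R]_p) (eps : R) :
  random_matrix ghat -> (forall x, first_eigenvector (S_w w X (Y x)) (ghat x)) ->
  0 < eps -> 0 < gap ->
  (P [set x | (eps < `|sign_dist (ghat x) g|)%R] <= (4 * K / (eps ^+ 2 * (r * gap)))%:E)%E.
Proof.
move=> mghat ghatP eps0 gap0.
have menorm (e : R) : measurable_fun [set: T] (fun x => enorm (e *: ghat x - g)).
  apply: (@measurableT_comp _ _ _ _ _ _ (@Num.sqrt R)).
    apply: continuous_measurable_fun; exact: sqrt_continuous.
  apply: measurable_sum => i; apply: measurable_funX.
  have -> : (fun x => (e *: ghat x - g) i 0) = (fun x => e * ghat x i 0 - g i 0).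
    by apply/funext => x; rewrite !mxE.
  apply: measurable_funB => //; apply: measurable_funM => //; exact: mghat.
have mD : measurable_fun [set: T] (fun x => `|sign_dist (ghat x) g|).
  apply: measurableT_comp => //.
  exact: measurable_minr.
have dpos : 0 <= n%:R * gap by rewrite mulr_ge0 ?ltW.
have key x : n%:R * gap * sign_dist (ghat x) g ^+ 2 <= 4 * W x.
  (* Signal and covariance share the direction [g], so the rank-one term and the spectral gap of
     [Sigma] add up in [n * gap]. *)
  apply: (@sign_dist_perturbation _ _ _ A _ _ (w * n%:R * lam`_1) _ _
    (S_w_sym _ _ _) (ghatP x) (gamma1_unit model)) => //.
  - move=> v; have := mform_spectral_gap v p_ge2 sS (Sigma_eigenvalues model)
      (gamma1_eigen model) (gamma1_unit model).
    have wn0 : 0 <= w * n%:R by have /andP[w0 _] := w01; rewrite mulr_ge0.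
    move=> /(ler_wpM2l wn0); rewrite /A mformDm !mformZm mform_rank1 /gap; lra.
  - rewrite /A mformDm !mformZm mform_rank1 (mform_eigen _ (gamma1_eigen model)).
    by rewrite (enorm1 (gamma1_unit model)) /gap; ring.
  - exact: mform_noise_le.
(* By [key], a distance above [eps] forces [W] to be at least this threshold; Markov's inequality
   then gives [r K / c1]. *)
pose c1 := n%:R * gap * eps ^+ 2 / 4.
have c10 : 0 < c1 by rewrite divr_gt0// !mulr_gt0// exprn_gt0.
have mA : measurable [set x | (eps < `|sign_dist (ghat x) g|)%R].
  rewrite (_ : [set x | _] = (fun x => `|sign_dist (ghat x) g|) @^-1` `]eps, +oo[); last first.
    by apply/seteqP; split=> x /=; rewrite in_itv /= andbT.
  by rewrite -[X in measurable X]setTI; exact: mD.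
apply: le_trans (markov_expect P nnW c10 mA _) _.
  move=> x /= h; rewrite /c1 ler_pdivrMr// mulrC [leRHS]mulrC.
  apply: le_trans (key x); rewrite mulrC ler_wpM2l//.
  by rewrite -(real_normK (num_real (sign_dist _ _))) ler_pXn2r ?nnegrE// ltW.
apply: le_trans (lee_wpmul2l _ expectW) _; first by rewrite lee_fin invr_ge0 ltW.
rewrite -EFinM lee_fin /c1 -rr le_eqVlt; apply/orP; left; apply/eqP.
by field; rewrite !gt_eqF.
Qed.

End FiniteSample.

(** * Eventual bounds extracted from Theta conditions, and limits *)

Section Asymptotics.
Variable R : realType.

Lemma theta_pow_ub (a : nat -> R) (u : R) : theta_pow a u ->
  exists C : R, \forall n \near \oo, a n / n%:R `^ u <= C.
Proof.
move=> [_]; rewrite /limn_esup /limf_esup => /ereal_inf_lt[_ [A FA <-]] supA.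
case: (ereal_sup _) (@ereal_sup_ubound R ((fun n => (a n / n%:R `^ u)%:E) @` A)) supA
  => [C| |]// h _.
  exists C; apply: filterS FA => n An.
  by rewrite -lee_fin; apply: h; exists n.
(* A supremum [-oo] over real values is contradictory, so any constant serves. *)
exists 0; apply: filterS FA => n An.
by have := h (a n / n%:R `^ u)%:E; rewrite leeNy_eq => /(_ (ex_intro2 _ _ n An erefl)).
Qed.

Lemma theta_pow_lb (a : nat -> R) (u : R) : theta_pow a u ->
  exists2 c : R, 0 < c & \forall n \near \oo, c <= a n / n%:R `^ u.
Proof.
move=> [+ _]; rewrite /limn_einf oppe_gt0.
rewrite /limn_esup /limf_esup => /ereal_inf_lt[_ [A FA <-]] supA.
case: (ereal_sup _) (@ereal_sup_ubound R ((\- (fun n => (a n / n%:R `^ u)%:E)) @` A)%E) supA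
  => [C| |]// h; last first.
  move=> _; exists 1 => //; apply: filterS FA => n An.
  by have := h _ (ex_intro2 _ _ n An erefl); rewrite leeNy_eq.
rewrite lte_fin => C0; exists (- C); first by rewrite oppr_gt0.
apply: filterS FA => n An.
by have := h _ (ex_intro2 _ _ n An erefl); rewrite /= lee_fin lerNl.
Qed.

Lemma cvg_powRN (C u : R) : 0 < u -> C * n%:R `^ (- u) @[n --> \oo] --> (0 : R).
Proof.
move=> u0; rewrite -(mulr0 C); apply: cvgM; first exact: cvg_cst.
apply/cvgrPdist_le => e e0; near=> n.
have n0 : 0 < n%:R :> R by rewrite ltr0n; near: n; exact: nbhs_infty_gt.
rewrite sub0r normrN ger0_norm ?powR_ge0//.
(* This exhibits the threshold on [n], namely [e^(-1/u)]. *)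
have -> : e = (e `^ (- u^-1)) `^ (- u).
  by rewrite -powRrM mulrNN mulVf ?gt_eqF// powRr1// ltW.
rewrite [leLHS]powRN [leRHS]powRN lef_pV2 ?posrE ?powR_gt0//.
apply: ge0_ler_powR; rewrite ?nnegrE ?powR_ge0// ?ltW//.
by near: n; exact: nbhs_infty_gtr.
Unshelve. all: by end_near. Qed.

Lemma cvg_mform k (A : nat -> 'M[R]_k) (M : 'M[R]_k) (v : 'cV[R]_k) :
  A n @[n --> \oo] --> M -> mform (A n) v v @[n --> \oo] --> mform M v v.
Proof.
move=> AM; rewrite mformE (_ : (fun n => _) =
  fun n => \sum_i \sum_j v i 0 * A n i j * v j 0); last first.
  by apply/funext => n; rewrite mformE.
apply: cvg_sumr => i; apply: cvg_sumr => j.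
apply: cvgM; last exact: cvg_cst.
apply: cvgM; first exact: cvg_cst.
exact: (cvg_comp A (fun B : 'M[R]_k => B i j) AM (@coord_continuous R k k i j M)).
Qed.

End Asymptotics.

(** * Consistency from the tail bound *)

Theorem theorem4p1 (R : realType) (p q : nat) (alpha : 'cV[R]_q) (w eta : R)
    (d : nat -> measure_display) (T : forall n, measurableType (d n))
    (P : forall n, probability (T n) R)
    (X : forall n, 'M[R]_(n, q)) (mu : nat -> 'cV[R]_p)
    (Sigma : nat -> 'M[R]_p) (lam : nat -> p.-tuple R)
    (gamma1 : nat -> 'cV[R]_p)
    (E Y : forall n, T n -> 'M[R]_(n, p))
    (gamma1_hat : forall n, T n -> 'cV[R]_p)
    (p_ge2 : (2 <= p)%N) (q_gt0 : (0 < q)%N) (w01 : 0 <= w <= 1)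
    (model : forall n, (1 + q < n)%N ->
       allometric_regression (P n) (X n) (mu n) alpha (Sigma n) (lam n)
         (gamma1 n) (E n) (Y n))
    (gamma1_hat_meas : forall n, (1 + q < n)%N -> random_matrix (gamma1_hat n))
    (gamma1_hatP : forall n, (1 + q < n)%N -> forall x : T n,
       first_eigenvector (S_w w (X n) (Y n x)) (gamma1_hat n x))
    (design_cvg : exists2 M : 'M[R]_q, posdef M &
       n%:R^-1 *: ((X n)^T *m X n) @[n --> \oo] --> M)
    (trace_Sigma : theta_pow (fun n => \tr (Sigma n)) 0)
    (trace_Sigma2 : theta_pow (fun n => \tr (Sigma n *m Sigma n)) 0)
    (eta_gt0 : 0 < eta)
    (eigengap : theta_pow (fun n => (lam n)`_0 - (lam n)`_1) (- eta)) :
  let consistent :=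
    cvg_to0_in_probability P
      (fun n x => sign_dist (gamma1_hat n x) (gamma1 n)) in
  [/\ w = 0 -> alpha != 0 -> consistent,
      0 < w < 1 -> alpha != 0 \/ eta < 2^-1 -> consistent
    & w = 1 -> eta < 2^-1 -> consistent].
Proof.
move=> consistent; have [M [_ Mpos] XM] := design_cvg; have /andP[w0 w1] := w01.
pose c n : R := n%:R^-1 * mform 1%:M (X n *m alpha) (X n *m alpha).
pose m := mform M alpha alpha.
have cm : c n @[n --> \oo] --> m.
  rewrite (_ : c = fun n => mform (n%:R^-1 *: ((X n)^T *m X n)) alpha alpha).
    exact: cvg_mform.
  apply/funext => n; rewrite /c mformZm; congr (_ * _).
  by rewrite /mform mulmx1 trmx_mul !mulmxA.
have c_ge0 n : 0 <= c n by rewrite mulr_ge0 ?mform1_ge0// invr_ge0.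
have [C trC] := theta_pow_ub trace_Sigma.
have gap_ge0 n : (1 + q < n)%N -> 0 <= (lam n)`_0 - (lam n)`_1.
  by move=> /model /first_eigenvalue_simple/ltW; rewrite subr_ge0.
have main theta c0 : theta < 2^-1 -> 0 < c0 ->
    (\forall n \near \oo, c0 * n%:R `^ (- theta) <=
       (1 - w) * c n + w * ((lam n)`_0 - (lam n)`_1)) -> consistent.
  move=> theta_lt c00 gap_ge eps eps0.
  (* The finite-sample constant made independent of [n]: eventually the trace is at most [C], and
     [c n], which tends to [m], is at most [m + 1]. *)
  pose K := 3 / 2 + (m + 1 + q%:R + 1) * C + 2 * p%:R ^+ 2 * C ^+ 2.
  pose B := 4 * K / (eps ^+ 2 * c0).
  have Bcvg : (B * n%:R `^ (- (2^-1 - theta)))%:E @[n --> \oo] --> 0%E.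
    apply: cvg_EFin; first exact: nearW.
    by apply: cvg_powRN; rewrite subr_gt0.
  apply: squeeze_cvge (cvg_cst 0%E) Bcvg.
  near=> n.
  have n0 : (0 < n)%N by near: n; exact: nbhs_infty_gt.
  have n1q : (1 + q < n)%N by near: n; exact: nbhs_infty_gt.
  have nR0 : 0 < n%:R :> R by rewrite ltr0n.
  have trn : \tr (Sigma n) <= C.
    by have : \tr (Sigma n) / n%:R `^ 0 <= C by [near: n]; rewrite powRr0 divr1.
  have cn : c n <= m + 1.
    near: n; apply: (cvgr_le m cm); lra.
  have gn : c0 * n%:R `^ (- theta) <=
       (1 - w) * c n + w * ((lam n)`_0 - (lam n)`_1) by near: n.
  have Mn := model n n1q.
  have tr0 : 0 <= \tr (Sigma n) := posdef_trace_ge0 (Sigma_posdef Mn).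
  have g0 : 0 < (1 - w) * c n + w * ((lam n)`_0 - (lam n)`_1).
    by apply: lt_le_trans gn; rewrite mulr_gt0// powR_gt0.
  rewrite measure_ge0 /=.
  apply: le_trans (sign_dist_tail_bound w01 n0 p_ge2 Mn (gamma1_hat_meas _ n1q)
    (gamma1_hatP _ n1q) eps0 g0) _.
  rewrite lee_fin -/(c n).
  have r0 : 0 < Num.sqrt n%:R :> R by rewrite sqrtr_gt0.
  have -> : B * n%:R `^ (- (2^-1 - theta)) =
      4 * K / (eps ^+ 2 * (Num.sqrt n%:R * (c0 * n%:R `^ (- theta)))).
    rewrite powRN powRB; last by rewrite pnatr_eq0 -lt0n n0 implybT.
    rewrite powR12_sqrt ?ltW// powRN /B; field.
    by rewrite !gt_eqF ?powR_gt0.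
  have K'K : 3 / 2 + (c n + q%:R + 1) * \tr (Sigma n) +
      2 * p%:R ^+ 2 * \tr (Sigma n) ^+ 2 <= K.
    rewrite /K; apply: lerD; first apply: lerD => //.
      apply: ler_pM => //; first by rewrite !addr_ge0.
      by rewrite !lerD2r.
    rewrite ler_wpM2l ?mulr_ge0 ?sqr_ge0//.
    by rewrite ler_pXn2r ?nnegrE// (le_trans tr0).
  apply: ler_pM.
  - rewrite mulr_ge0// !addr_ge0// ?mulr_ge0 ?sqr_ge0//.
    by rewrite !addr_ge0.
  - by rewrite invr_ge0 !mulr_ge0 ?sqr_ge0// ltW.
  - by rewrite ler_pM2l.
  - rewrite lef_pV2 ?posrE ?mulr_gt0 ?exprn_gt0 ?powR_gt0//.
    by rewrite ler_pM2l ?exprn_gt0// ler_pM2l.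
have signal : w < 1 -> alpha != 0 -> consistent.
  move=> wlt1 alpha0; have m0 : 0 < m by exact: Mpos.
  (* Since [c n] tends to [m > 0], it eventually exceeds [m / 2]; the eigenvalue term is dropped as
     nonnegative. *)
  apply: (main 0 ((1 - w) * (m / 2))) => //; first by rewrite mulr_gt0 ?subr_gt0// divr_gt0.
  near=> n; rewrite oppr0 powRr0 mulr1 ler_wpDr//.
    by rewrite mulr_ge0// gap_ge0//; near: n; exact: nbhs_infty_gt.
  rewrite ler_wpM2l ?subr_ge0//.
  near: n; apply: (cvgr_ge m cm); lra.
have noise : 0 < w -> eta < 2^-1 -> consistent.
  move=> w_gt0 eta_lt; have [c0 c00 gap] := theta_pow_lb eigengap.
  (* Here the signal term is the one dropped, and [c0] is the eventual lower bound on the rescaled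
     eigenvalue gap. *)
  apply: (main eta (w * c0)) => //; first by rewrite mulr_gt0.
  near=> n; rewrite ler_wpDl//; first by rewrite mulr_ge0// subr_ge0.
  rewrite -mulrA ler_wpM2l// -ler_pdivlMr; last first.
    by rewrite powR_gt0// ltr0n; near: n; exact: nbhs_infty_gt.
  by near: n.
split=> [wE|/andP[w_gt0 w_lt1] [|]|wE].
- by apply: signal; rewrite wE.
- exact: signal.
- exact: noise.
- by apply: noise; rewrite wE.
Unshelve. all: by end_near. Qed.
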